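(* Let $N\in\mathbb N$ (nonharmonic bandwidth), let $N_1=\sigma_1N\in 2\mathbb N$ with $\sigma_1>1$, and let $m_1\in\mathbb N\setminus\{1\}$ with $2m_1<N_1$. Let $N_2=\sigma_2(N_1+2m_1)\in 2\mathbb N$ with $\sigma_2>1$, and let $m_2\in\mathbb N\setminus\{1\}$ with $2m_2\le\big(1-\frac1{\sigma_1}\big)N_2$. Let $\omega_j\in\Omega(m_j,\sigma_j)$ and $\varphi_j(t)=\omega_j\big(\frac{N_jt}{m_j}\big)$, $t\in\mathbb R$, for $j=1,2$. Let $M_1,M_2\in2\mathbb N$, let $x_j\in[-\frac12,\frac12]$, $j\in\mathcal I_{M_2}$, be arbitrary nodes, let $f_k\in\mathbb C$, $k\in\mathcal I_{M_1}$, be arbitrary coefficients, and let $a=1+\frac{2m_1}{N_1}$. Then for the exponential sum $$f(x)=\sum_{k\in\mathcal I_{M_1}}f_k\,\mathrm e^{-2\pi\mathrm iNv_kx},\qquad x\in[-\tfrac12,\tfrac12],$$ with arbitrary $v_k\in[-\frac1{2a},\frac1{2a}]$, $k\in\mathcal I_{M_1}$, and its NNFFT approximation $s_1(Nx)/\hat\varphi_1(Nx)$, we have $$\max_{j\in\mathcal I_{M_2}}\Big|f(x_j)-\frac{s_1(Nx_j)}{\hat\varphi_1(Nx_j)}\Big|\le\max_{x\in[-1/2,1/2]}\Big|f(x)-\frac{s_1(Nx)}{\hat\varphi_1(Nx)}\Big|\le\Big[E_{\sigma_1}(\varphi_1)+\frac{a}{\hat\varphi_1(\frac N2)}E_{\sigma_2}(\varphi_2)\Big]\sum_{k\in\mathcal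 I_{M_1}}|f_k|.$$
   Context: $\mathbb N$ is the set of positive integers. For $M\in2\mathbb N$, $\mathcal I_M=\{-\frac M2,1-\frac M2,\dots,\frac M2-1\}$. The Fourier transform is $\hat g(v)=\int_{\mathbb R}g(x)\mathrm e^{-2\pi\mathrm ivx}\,\mathrm dx$. For $m\in\mathbb N\setminus\{1\}$ and $\sigma>1$, $\Omega(m,\sigma)$ is the set of functions $\omega:\mathbb R\to[0,1]$ such that: $\omega$ is even, has support $[-1,1]$ and is continuous on $\mathbb R$; $\omega|_{[0,1]}$ is decreasing with $\omega(0)=1$; $\hat\omega$ is positive and decreasing on $[0,\frac m{2\sigma}]$. General error constant: for $\omega\in\Omega(m,\sigma)$ and $K\in\mathbb N$ with $\sigma K\in2\mathbb N$, put $\varphi^{[K]}(t)=\omega\big(\frac{\sigma Kt}m\big)$ and $$E_{\sigma,K}(\varphi)=\max_{v\in[-K/2,K/2]}\Big\|\sum_{r\in\mathbb Z\setminus\{0\}}\frac{\widehat{\varphi^{[K]}}(v+r\sigma K)}{\widehat{\varphi^{[K]}}(v)}\mathrm e^{2\pi\mathrm ir\sigma K\,\cdot}\Big\|_{C(\mathbb T)},\qquad E_\sigma(\varphi)=\sup_KE_{\sigma,K}(\varphi),$$ the supremum being over all $K\in\mathbb N$ with $\sigma K\in 2\mathbb N$. Here $\|g\|_{C(\mathbb T)}=\max_{x\in[-1/2,1/2]}|g(x)|$ for continuous 1-periodic $g$, and Fourier series are limits of symmetric partial sums. $E_{\sigma_1}(\varphi_1)$ is formed with $(\omega_1,m_1,\sigma_1)$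 (so $\varphi_1=\varphi^{[N]}$), and $E_{\sigma_2}(\varphi_2)$ with $(\omega_2,m_2,\sigma_2)$ (so $\varphi_2=\varphi^{[N_1+2m_1]}$). NNFFT: given coefficients $f_k$, frequencies $v_k$, and windows $\varphi_1,\varphi_2$, set $$g_\ell=\frac1{N_1}\sum_kf_k\,\varphi_1\Big(\frac\ell{N_1}-v_k\Big)\quad(\ell\in\mathcal I_{N_1+2m_1}),\qquad h_s=\frac1{N_2}\sum_{\ell\in\mathcal I_{N_1+2m_1}}\frac{g_\ell}{\hat\varphi_2(\ell)}\mathrm e^{-2\pi\mathrm i\ell s/N_2}\quad(s\in\mathcal I_{N_2}),$$ $$s_1(Nx)=\sum_{s\in\mathcal I_{N_2}}h_s\,\varphi_2\Big(\frac x{\sigma_1}-\frac s{N_2}\Big),\qquad x\in[-\tfrac12,\tfrac12].$$ The NNFFT approximates $f(x)$ by $s_1(Nx)/\hat\varphi_1(Nx)$. *)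

(* Defs.v *)
From mathcomp Require Import all_boot all_order all_algebra.
From mathcomp Require Import complex.
From mathcomp Require Import all_classical all_reals all_analysis.

Set Implicit Arguments.
Unset Strict Implicit.
Unset Printing Implicit Defensive.

Import Order.TTheory GRing.Theory Num.Theory.
Import numFieldNormedType.Exports.
Import Normc.

Local Open Scope classical_set_scope.
Local Open Scope ring_scope.
Local Open Scope complex_scope.

(* M \in 2N, where 0 is not in N *)
Definition pos_even (M : nat) : bool := (0 < M)%N && ~~ odd M.

(* -M/2, 1 - M/2, ..., M/2 - 1, for even M *)
Definition idx (M : nat) : seq int :=
  [seq i%:Z - (M./2)%:Z | i <- iota 0 M].

Definition is_maximum (R : realType) (A : set R) (y : R) : Prop :=
  A y /\ ubound A y.

(* hence sup below is the maximum wherever the maximum exists *)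
Lemma is_maximum_sup (R : realType) (A : set R) (y : R) :
  is_maximum A y -> sup A = y.
Proof.
move=> [Ay uy]; apply/eqP; rewrite eq_le; apply/andP; split.
  by apply: ge_sup => //; exists y.
by apply: ub_le_sup => //; exists y.
Qed.

(* e^{2 pi i t} *)
Definition e2pii (R : realType) (t : R) : R[i] :=
  cos (2 * pi * t) +i* sin (2 * pi * t).

Definition cintegral (R : realType) (g : R -> R[i]) : R[i] :=
  Rintegral lebesgue_measure setT (fun x => complex.Re (g x))
  +i* Rintegral lebesgue_measure setT (fun x => complex.Im (g x)).

Definition fourier (R : realType) (g : R -> R) (v : R) : R[i] :=
  cintegral (fun x => (g x)%:C * e2pii (- (v * x))).

(* The order on R[i] only relates numbers with equal imaginary parts, so the
   last two fields also say that the transform is real-valued there.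
   "Decreasing" is not required to be strict. *)
Record Omega (R : realType) (m : nat) (sigma : R) (w : R -> R) : Prop := {
  Omega_range : forall t, 0 <= w t <= 1 ;
  Omega_even : forall t, w (- t) = w t ;
  Omega_support : closure [set t | w t != 0] = `[-1, 1]%classic ;
  Omega_continuous : continuous w ;
  Omega_decr : forall s t, 0 <= s -> s <= t -> t <= 1 -> w t <= w s ;
  Omega_one : w 0 = 1 ;
  Omega_fourier_pos : forall v, 0 <= v -> v <= m%:R / (2 * sigma) ->
    0 < fourier w v ;
  Omega_fourier_decr : forall u v, 0 <= u -> u <= v ->
    v <= m%:R / (2 * sigma) -> fourier w v <= fourier w u
}.

(* t |-> w (L t / m): the window phi^[K] for L = sigma K, and phi_j for
   L = N_j *)
Definition scaled_window (R : realType) (w : R -> R) (m : nat) (L : R)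
  (t : R) : R := w (L * t / m%:R).

(* sum over the nonzero integers, as a limit of symmetric partial sums *)
Definition symm_series (R : realType) (u : int -> R[i]) : R[i] :=
  limn (fun n : nat =>
    \sum_(1 <= r < n.+1) (u r%:Z + u (- r%:Z)) : R[i]^o).

(* norm of C(T), for g continuous and 1-periodic; the supremum is attained *)
Definition norm_CT (R : realType) (g : R -> R[i]) : R :=
  sup [set normc (g x) | x in `[- 2^-1, 2^-1]%classic].

Definition alias_series (R : realType) (w : R -> R) (m : nat) (sigma : R)
    (K : nat) (v x : R) : R[i] :=
  let phi := scaled_window w m (sigma * K%:R) in
  symm_series (fun r : int =>
    fourier phi (v + r%:~R * sigma * K%:R) / fourier phi v
    * e2pii (r%:~R * sigma * K%:R * x)).

(* By Poisson summation the series in alias_series converges to a jointly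
   continuous function of (v, x), so this supremum is attained too. *)
Definition error_const_K (R : realType) (w : R -> R) (m : nat) (sigma : R)
    (K : nat) : R :=
  sup [set norm_CT (alias_series w m sigma K v)
      | v in `[- (K%:R / 2), K%:R / 2]%classic].

(* error_const_K only depends on K through the admissibility of K, so the
   supremum is finite. *)
Definition error_const (R : realType) (w : R -> R) (m : nat) (sigma : R) : R :=
  sup [set error_const_K w m sigma K | K in
        [set K : nat | (0 < K)%N /\
           exists2 L : nat, pos_even L & sigma * K%:R = L%:R]].

Definition exp_sum (R : realType) (N M1 : nat) (f : int -> R[i])
    (v : int -> R) (x : R) : R[i] :=
  \sum_(k <- idx M1) f k * e2pii (- (N%:R * v k * x)).

Section NNFFT.
Variables (R : realType) (N1 m1 N2 M1 : nat) (sigma1 : R).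
Variables (phi1 phi2 : R -> R) (f : int -> R[i]) (v : int -> R).

Definition nnfft_g (l : int) : R[i] :=
  (N1%:R)^-1 * \sum_(k <- idx M1) f k * (phi1 (l%:~R / N1%:R - v k))%:C.

Definition nnfft_h (s : int) : R[i] :=
  (N2%:R)^-1 * \sum_(l <- idx (N1 + 2 * m1))
    nnfft_g l / fourier phi2 l%:~R * e2pii (- (l%:~R * s%:~R / N2%:R)).

(* as a function of x this is s_1(N x) *)
Definition nnfft_s1 (x : R) : R[i] :=
  \sum_(s <- idx N2) nnfft_h s * (phi2 (x / sigma1 - s%:~R / N2%:R))%:C.

End NNFFT.

(* Main.v *)
Require Import Defs.
From mathcomp Require Import all_boot all_order all_algebra.
From mathcomp Require Import complex.
From mathcomp Require Import all_classical all_reals all_analysis.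
From mathcomp Require Import measurable_realfun.
From mathcomp Require Import ring lra zify.

(** Each of the two steps of the algorithm is one instance of Poisson summation.
    For a window phi supported in [-m/L, m/L],
<<
      L^-1 * \sum_j phi (x + j/L) e(- v (x + j/L)) = \sum_r phi^ (v + r L) e(r L x),
>>
    and after division by phi^ v the term r = 0 is 1 while the others form the
    alias series whose norm defines the error constant.  Multiplication by the
    unimodular e(v x) shows that replacing the exponential e(v x) by a window
    sum costs at most the error constant ([window_error]).  The choice L = N1,
    v = N y, x = - v_k gives the first step, the choice L = N2, v = - l,
    x = y / sigma1 the second one; the hypotheses on v_k and m2 say that the
    finite index sets contain all nonzero terms.  The total error is the first
    one weighted by the f_k plus the second one weighted by g_l / phi1^ (N y).
    Since the windows are bounded by 1, \sum_l |g_l| <= a \sum_k |f_k|, and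
    phi1^ (N y) is smallest at the edge of the band ([err_le]).

    The analytic content is the convergence of the alias series.  A window is
    only continuous and monotone on the half-line, its transform need not be
    summable, and the symmetric partial sums converge by Jordan's theorem for
    functions of bounded variation.  Here the layer-cake formula writes a
    monotone g on the half-line as a superposition of indicators of intervals
    [0, s[.  For an indicator the partial sum is a difference of two values of
    the primitive x + \sum_r sin (2 pi r x) / (pi r) of the Dirichlet kernel,
    which is bounded uniformly in n and converges to the staircase
    (floor x + ceil x) / 2.  Dominated convergence over the layers yields
    [jordan_halfline].  The Fourier factors cos and sin are not monotone, but
    adding a steep linear function makes them so ([jordan_bump]); the two
    half-lines are then glued in [poisson_summation].

    The suprema in the error constants are finite because the window sum has a
    bounded number of nonzero terms and the transform is bounded below on the
    band by its value at the edge ([normc_alias_series]).  The maximum of the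
    error exists by continuity on a segment. *)

Set Implicit Arguments.
Unset Strict Implicit.
Unset Printing Implicit Defensive.

Import Order.TTheory GRing.Theory Num.Theory.
Import numFieldNormedType.Exports.
Import Normc.

Local Open Scope classical_set_scope.
Local Open Scope ring_scope.
Local Open Scope complex_scope.


(** * The Dirichlet kernel and its primitive *)

Definition dirichlet (R : realType) (n : nat) (x : R) : R :=
  1 + \sum_(1 <= r < n.+1) 2 * cos (2 * pi * r%:R * x).

Definition sawtooth_sum (R : realType) (n : nat) (x : R) : R :=
  \sum_(1 <= r < n.+1) sin (2 * pi * r%:R * x) / (pi * r%:R).

(** The primitive of the Dirichlet kernel; its limit is a staircase with a unit
    jump at every integer. *)
Definition staircase_sum (R : realType) (n : nat) (x : R) : R :=
  x + sawtooth_sum n x.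

Section kernel.
Variable R : realType.
Implicit Types x y : R.

Let pi_neq0 : (pi : R) != 0. Proof. by rewrite gt_eqF // pi_gt0. Qed.

Lemma sinD_sinB x y : sin (x + y) - sin (x - y) = 2 * (cos x * sin y).
Proof. by rewrite sinB sinD; ring. Qed.

Lemma is_derive_staircase n x :
  is_derive x (1 : R) (staircase_sum n) (dirichlet n x).
Proof.
elim: n => [|n IHn].
  rewrite /dirichlet big_nil addr0.
  rewrite (_ : staircase_sum 0 = id); first exact: is_derive_id.
  by apply/funext => y; rewrite /staircase_sum /sawtooth_sum big_nil addr0.
rewrite (_ : staircase_sum n.+1 =
    staircase_sum n + (fun y => sin (2 * pi * n.+1%:R * y) / (pi * n.+1%:R))).
  apply: is_derive_eq.
  rewrite /dirichlet [in RHS](@big_nat_recr _ _ _ n.+1) //= [in RHS]addrA; congr (_ + _).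
  rewrite /GRing.scale /= mulr0 add0r mulr1.
  rewrite (_ : _ * (2 * pi * n.+1%:R) =
    (2 * cos (2 * pi * n.+1%:R * x)) * (pi * n.+1%:R)); last by ring.
  by rewrite mulrC mulfK // mulf_neq0 // pnatr_eq0.
by apply/funext => y; rewrite /staircase_sum /sawtooth_sum big_nat_recr //= fctE addrA.
Qed.

Lemma dirichlet_sin n x : dirichlet n x * sin (pi * x) = sin ((2 * n + 1)%:R * pi * x).
Proof.
elim: n => [|n IHn].
  by rewrite /dirichlet big_nil addr0 mul1r muln0 add0n mul1r.
rewrite /dirichlet big_nat_recr //= addrA mulrDl IHn.
rewrite -[_ * _ * sin _]mulrA -sinD_sinB.
rewrite (_ : 2 * pi * n.+1%:R * x + pi * x = (2 * n.+1 + 1)%:R * pi * x); last first.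
  by rewrite !natrD natrM; ring.
rewrite (_ : 2 * pi * n.+1%:R * x - pi * x = (2 * n + 1)%:R * pi * x); last first.
  by rewrite natrD natrM -natr1; ring.
by ring.
Qed.

Lemma norm_sin_natmul n x : `|sin (n%:R * x)| <= n%:R * `|sin x|.
Proof.
elim: n => [|n IHn]; first by rewrite !mul0r sin0 normr0.
rewrite -natr1 !mulrDl !mul1r sinD.
apply: (le_trans (ler_normD _ _)); rewrite !normrM lerD //.
  by rewrite -[leRHS]mulr1 ler_pM // ?cos_max.
by rewrite -[leRHS]mul1r ler_pM // ?cos_max.
Qed.

Lemma sin_pi_int (k : int) : sin (pi * k%:~R : R) = 0.
Proof.
have H (n : nat) : sin (pi * n%:R : R) = 0.
  elim: n => [|n IHn]; first by rewrite mulr0 sin0.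
  by rewrite -natr1 mulrDr mulr1 sinDpi IHn oppr0.
case: k => n; first exact: H.
by rewrite NegzE mulrNz mulrN sinN H oppr0.
Qed.

Lemma cos_2pi_int (k : int) : cos (2 * pi * k%:~R : R) = 1.
Proof.
rewrite (_ : 2 * pi * k%:~R = (pi * k%:~R) *+ 2 :> R); last by ring.
by rewrite cos_mulr2n cos2sin2 sin_pi_int expr0n /= subr0 mulr2n addrK.
Qed.

Lemma sin_2pi_int (k : int) : sin (2 * pi * k%:~R : R) = 0.
Proof. by rewrite -[2]/(2%:~R) -mulrA mulrCA -intrM sin_pi_int. Qed.

Lemma sin_2piDint (k : int) x : sin (x + 2 * pi * k%:~R) = sin x.
Proof. by rewrite sinD cos_2pi_int sin_2pi_int mulr1 mulr0 addr0. Qed.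

Lemma sawtooth_sumDint n x (k : int) :
  sawtooth_sum n (x + k%:~R) = sawtooth_sum n x.
Proof.
apply: eq_bigr => r _; congr (_ / _).
rewrite mulrDr (_ : 2 * pi * r%:R * k%:~R = 2 * pi * (r%:Z * k)%:~R).
  exact: sin_2piDint.
by rewrite intrM mulrA.
Qed.

Lemma staircase_half n : staircase_sum n (2^-1 : R) = 2^-1.
Proof.
rewrite /staircase_sum /sawtooth_sum big1 ?addr0 // => r _.
rewrite (_ : 2 * pi * r%:R / 2 = pi * r%:Z%:~R); last by field.
by rewrite sin_pi_int mul0r.
Qed.

(** The added quotient cancels the oscillation of the Dirichlet kernel: for
    e = 1 and for e = - 1 the derivative that remains has a constant sign. *)
Lemma is_derive_comparison n (e : R) x (c := (2 * n + 1)%:R * pi : R) :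
  sin (pi * x) != 0 ->
  is_derive x (1 : R)
   (fun y => staircase_sum n y + (cos (c * y) + e * cos (pi * y)) / (c * sin (pi * y)))
   (- (pi / (c * sin (pi * x) ^+ 2)) * (cos (c * x) * cos (pi * x) + e)).
Proof.
move=> s0.
have c0 : c != 0 by rewrite mulf_neq0 // pnatr_eq0 addn1.
have cs0 : c * sin (pi * x) != 0 by rewrite mulf_neq0.
have dK := is_derive_staircase n x.
have dV := @is_deriveV R (fun y => c * sin (pi * y)) x 1 _ cs0.
rewrite (_ : (fun y => _) = staircase_sum n +
   (fun y => cos (c * y) + e * cos (pi * y)) * (fun y => (c * sin (pi * y))^-1)) //.
apply: is_derive_eq.
rewrite /GRing.scale /= .
have -> : dirichlet n x = sin (c * x) / sin (pi * x).
  by rewrite -dirichlet_sin mulfK.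
have := cos2Dsin2 (pi * x).
set C := cos (pi * x); set S := sin (pi * x); move=> CS.
have -> : cos (c * x) * C + e = cos (c * x) * C + e * (C ^+ 2 + S ^+ 2).
  by rewrite CS mulr1.
move: c0 s0; rewrite -/S; clearbody c S => c0 S0.
by field; rewrite c0 S0.
Qed.

(** The comparison functions for e = 1 and e = - 1 are monotone in opposite
    directions and both equal 1/2 at 1/2, so they trap the staircase sum; no
    oscillatory integral has to be estimated. *)
Lemma norm_staircaseB n x : 0 < x < 1 ->
  `|staircase_sum n x - 2^-1| <= 2 / ((2 * n + 1)%:R * pi * sin (pi * x)).
Proof.
move=> x01; set c := (2 * n + 1)%:R * pi.
have c_gt0 : 0 < c by rewrite mulr_gt0 ?pi_gt0 // ltr0n addn1.
have sin_gt0 y : 0 < y < 1 -> 0 < sin (pi * y).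
  move=> /andP[y0 y1]; rewrite sin_gt0_pi // mulr_gt0 ?pi_gt0 //=.
  by rewrite -[ltRHS]mulr1 ltr_pM2l ?pi_gt0.
pose H (e : R) y :=
  staircase_sum n y + (cos (c * y) + e * cos (pi * y)) / (c * sin (pi * y)).
have dH e y : y \in `]0, 1[ -> is_derive y (1 : R) (H e)
   (- (pi / (c * sin (pi * y) ^+ 2)) * (cos (c * y) * cos (pi * y) + e)).
  rewrite in_itv /= => y01; apply: is_derive_comparison.
  by rewrite gt_eqF ?sin_gt0.
have Hhalf e : H e 2^-1 = 2^-1.
  rewrite /H staircase_half cos_pihalf mulr0 addr0 /c.
  rewrite (_ : _ * pi / 2 = pi / 2 + pi * n%:Z%:~R); last first.
    by rewrite natrD natrM; field.
  by rewrite cosD cos_pihalf sin_pi_int mul0r mulr0 subrr mul0r addr0.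
have cH e : {in `]0, 1[, continuous (H e)}.
  move=> y y01; apply: differentiable_continuous; apply/derivable1_diffP.
  by case: (dH e y y01).
have ccN1 y : -1 <= cos (c * y) * cos (pi * y) <= 1.
  rewrite -ler_norml normrM -[leRHS]mulr1.
  by rewrite ler_pM // cos_max.
have fac_ge0 y : 0 <= pi / (c * sin (pi * y) ^+ 2).
  by rewrite divr_ge0 ?pi_ge0 // mulr_ge0 ?(ltW c_gt0) ?sqr_ge0.
have decr y z : 0 < y -> y <= z -> z < 1 -> H 1 z <= H 1 y.
  move=> y0 yz z1; apply: (@ler0_derive1_le_oo R (H 1) 0 1) => //.
  - by move=> u u01; case: (dH 1 u u01).
  - move=> u u01; rewrite derive1E; have [_ ->] := dH 1 u u01.
    rewrite mulNr oppr_le0; apply: (mulr_ge0 (fac_ge0 u)).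
    by have /andP[? _] := ccN1 u; lra.
  - by move=> u; rewrite inE; exact: cH.
  - by rewrite in_itv /= z1 andbT (lt_le_trans y0).
  - by rewrite in_itv /= y0 (le_lt_trans yz).
have incr y z : 0 < y -> y <= z -> z < 1 -> H (-1) y <= H (-1) z.
  move=> y0 yz z1; apply: (@ger0_derive1_le_oo R (H (-1)) 0 1) => //.
  - by move=> u u01; case: (dH (-1) u u01).
  - move=> u u01; rewrite derive1E; have [_ ->] := dH (-1) u u01.
    rewrite mulNr oppr_ge0; apply: (mulr_ge0_le0 (fac_ge0 u)).
    by have /andP[_ ?] := ccN1 u; lra.
  - by move=> u; rewrite inE; exact: cH.
  - by rewrite in_itv /= y0 (le_lt_trans yz).
  - by rewrite in_itv /= z1 andbT (lt_le_trans y0).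
have s_gt0 : 0 < c * sin (pi * x) by rewrite mulr_gt0 ?sin_gt0.
have bnd (e : R) : e ^+ 2 = 1 ->
    `|(cos (c * x) + e * cos (pi * x)) / (c * sin (pi * x))| <= 2 / (c * sin (pi * x)).
  move=> e1; rewrite normrM [X in _ * X]gtr0_norm ?invr_gt0 // ler_pM2r ?invr_gt0 //.
  apply: (le_trans (ler_normD _ _)); rewrite -[2]/(1 + 1) lerD ?cos_max //.
  rewrite normrM -[leRHS]mulr1 ler_pM ?cos_max //.
  by rewrite -(@expr_le1 _ 2) // real_normK ?num_real // e1.
have B1 := bnd 1 (expr1n _ _).
have B2 := bnd (-1) (etrans (sqrrN 1) (expr1n _ _)).
move: B1 B2; rewrite !ler_norml => /andP[B11 B12] /andP[B21 B22].
have /andP[x0 x1] := x01.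
have [xh|/ltW hx] := leP x 2^-1.
  have := decr x 2^-1 x0 xh; have := incr x 2^-1 x0 xh.
  rewrite !Hhalf /H => I D; have {}I := I ltac:(lra); have {}D := D ltac:(lra).
  by apply/andP; split; lra.
have := decr 2^-1 x _ hx x1; have := incr 2^-1 x _ hx x1.
rewrite !Hhalf /H => I D; have {}I := I ltac:(lra); have {}D := D ltac:(lra).
by apply/andP; split; lra.
Qed.

Lemma norm_sawtooth_sum_sin n x : `|sawtooth_sum n x| <= 2 * n%:R * `|sin (pi * x)| / pi.
Proof.
apply: (le_trans (ler_norm_sum _ _ _)).
apply: (@le_trans _ _ (\sum_(1 <= r < n.+1) 2 * `|sin (pi * x)| / pi)); last first.
  rewrite sumr_const_nat subn1 /= -mulr_natl.
  by rewrite le_eqVlt; apply/orP; left; apply/eqP; ring.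
rewrite !big_nat; apply: ler_sum => r /andP[r1 _].
have r0 : 0 < r%:R :> R by rewrite ltr0n.
rewrite normrM [X in _ * X]gtr0_norm ?invr_gt0 ?mulr_gt0 ?pi_gt0 //.
rewrite ler_pdivrMr ?mulr_gt0 ?pi_gt0 //.
rewrite (_ : _ * (pi * r%:R) = 2 * (r%:R * `|sin (pi * x)|)); last first.
  by rewrite mulrA divfK // mulrAC mulrA.
rewrite (_ : 2 * pi * r%:R * x = (r%:R * (pi * x)) *+ 2); last by rewrite mulr2n; ring.
rewrite sin_mulr2n -mulr_natl normrM ger0_norm // ler_pM2l //.
rewrite normrM; apply: le_trans (norm_sin_natmul _ _).
by rewrite -[leRHS]mul1r ler_pM // cos_max.
Qed.

(** The domination for the limit over the layers.  Where (2n+1) sin (pi y) >= 1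
    it follows from [norm_staircaseB]; elsewhere |sin (r y)| <= r |sin y| bounds
    each term by a multiple of sin (pi y). *)
Lemma norm_sawtooth_sum n x : `|sawtooth_sum n x| <= 2.
Proof.
have -> : x = (x - (Num.floor x)%:~R) + (Num.floor x)%:~R by rewrite subrK.
rewrite sawtooth_sumDint; set y := x - _.
have /andP[y0 y1] : 0 <= y < 1.
  have /andP[] := floor_itv x; rewrite /y intrD => ? ?; lra.
have pi2 := @pi_ge2 R.
have c_gt0 : 0 < (2 * n + 1)%:R :> R by rewrite ltr0n addn1.
have s0 : 0 <= sin (pi * y).
  apply: sin_ge0_pi; rewrite mulr_ge0 ?pi_ge0 //=.
  by rewrite -[leRHS]mulr1 ler_pM2l ?pi_gt0 // ltW.
have [big|small] := leP 1 ((2 * n + 1)%:R * sin (pi * y)); last first.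
  apply: (le_trans (norm_sawtooth_sum_sin _ _)).
  rewrite ger0_norm // ler_pdivrMr ?pi_gt0 //.
  move: small; rewrite natrD natrM; nra.
have yp : 0 < y.
  rewrite lt_neqAle y0 andbT; apply/eqP => y00.
  by move: big; rewrite -y00 mulr0 sin0 mulr0 lt_geF.
have := @norm_staircaseB n y; rewrite yp y1 => /(_ isT).
move=> /le_trans /(_ (_ : _ <= 1)) H.
have {H} : `|staircase_sum n y - 2^-1| <= 1.
  apply: H; rewrite ler_pdivrMr.
    by rewrite mul1r mulrAC; nra.
  by rewrite mulrAC mulr_gt0 ?pi_gt0 // (lt_le_trans _ big).
rewrite /staircase_sum !ler_norml => /andP[? ?]; apply/andP; split; lra.
Qed.

(** At an integer all sines vanish and the limit is the mid-jump value, which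
    (floor x + ceil x) / 2 encodes. *)
Lemma cvg_staircase x :
  staircase_sum n x @[n --> \oo] --> ((Num.floor x + Num.ceil x)%:~R / 2 : R).
Proof.
have -> : (fun n => staircase_sum n x) =
   (fun n => staircase_sum n (x - (Num.floor x)%:~R) + (Num.floor x)%:~R).
  apply/funext => n; rewrite /staircase_sum.
  by rewrite -{2}(subrK (Num.floor x)%:~R x) sawtooth_sumDint; ring.
set y := x - _.
have /andP[y0 y1] : 0 <= y < 1.
  have /andP[] := floor_itv x; rewrite /y intrD => ? ?; lra.
have [xint|xnint] := boolP (x \is a Num.int).
  have yE : y = 0 by rewrite /y floorK ?subrr.
  have -> : (fun n => staircase_sum n y + (Num.floor x)%:~R) = fun=> (Num.floor x)%:~R.
    apply/funext => n; rewrite yE /staircase_sum /sawtooth_sum big1 ?add0r // => r _.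
    by rewrite mulr0 sin0 mul0r.
  have -> : (Num.floor x + Num.ceil x)%:~R / 2 = (Num.floor x)%:~R :> R.
    by rewrite intrD floorK // ceilK //; field.
  exact: cvg_cst.
have -> : (Num.floor x + Num.ceil x)%:~R / 2 = 2^-1 + (Num.floor x)%:~R :> R.
  by rewrite ceil_floor xnint !intrD mulr1z; field.
apply: cvgD; last exact: cvg_cst.
have yp : 0 < y.
  rewrite lt_neqAle y0 andbT eq_sym subr_eq0; apply: contra xnint => /eqP ->.
  by rewrite intr_int.
have s0 : 0 < sin (pi * y).
  apply: sin_gt0_pi; rewrite mulr_gt0 ?pi_gt0 //=.
  by rewrite -[ltRHS]mulr1 ltr_pM2l ?pi_gt0.
apply/cvgrPdist_le => e e0; near=> n.
rewrite distrC (le_trans (norm_staircaseB _ _)) ?yp //.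
have k0 : 0 < pi * sin (pi * y) by rewrite mulr_gt0 ?pi_gt0.
rewrite -mulrA ler_pdivrMr ?mulr_gt0 ?pi_gt0 ?ltr0n ?addn1 //.
rewrite mulrCA -ler_pdivrMr ?mulr_gt0 ?pi_gt0 //.
apply: (@le_trans _ _ n%:R); last by rewrite ler_nat; lia.
near: n; exact: nbhs_infty_ger.
Unshelve. all: by end_near. Qed.

End kernel.

(** * Jordan's theorem on a half-line *)

Section integrals.
Variable R : realType.
Notation mu := (@lebesgue_measure R).
Implicit Types g h : R -> R.

Lemma continuous_itv_integrable (a b : R) h : continuous h ->
  mu.-integrable `[a, b] (EFin \o h).
Proof.
move=> ch; apply: continuous_compact_integrable; first exact: segment_compact.
exact: continuous_subspaceT.
Qed.

Lemma bounded_on_itv (a b : R) h : continuous h ->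
  exists2 B, 0 <= B & forall t, a <= t <= b -> `|h t| <= B.
Proof.
move=> ch; have [ab|ba] := leP a b; last first.
  by exists 0 => // t /andP[at_ tb]; move: (le_trans at_ tb); rewrite leNgt ba.
have ca : {within `[a, b], continuous (fun t => `|h t|)}.
  apply: continuous_subspaceT => t; apply: continuous_comp; first exact: ch.
  exact: norm_continuous.
have [c _ Hc] := EVT_max ab ca.
by exists `|h c| => // t tab; apply: Hc; rewrite in_itv.
Qed.

Lemma continuous_dirichlet n : continuous (@dirichlet R n).
Proof.
move=> x; apply: cvgD; first exact: cvg_cst.
apply: cvg_big => [|r _]; first exact: add_continuous.
apply: cvgM; first exact: cvg_cst.
apply: continuous_comp; last exact: continuous_cos.
by apply: cvgM; [exact: cvg_cst|exact: cvg_id].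
Qed.

Lemma continuous_dirichletB n (theta : R) :
  continuous (fun t => dirichlet n (theta - t)).
Proof.
move=> t; apply: (@continuous_comp _ _ _ (fun t : R => theta - t) (@dirichlet R n)).
  by apply: cvgB; [exact: cvg_cst|exact: cvg_id].
exact: continuous_dirichlet.
Qed.

Lemma integral_dirichlet n (theta s : R) : 0 < s ->
  (\int[mu]_(t in `[0%R, s]) (dirichlet n (theta - t))%:E =
   (staircase_sum n theta - staircase_sum n (theta - s))%:E)%E.
Proof.
move=> s0; pose F t := - staircase_sum n (theta - t).
have dF (t : R) : is_derive t (1 : R) F (dirichlet n (theta - t)).
  have dK := is_derive_staircase n (theta - t).
  have dK2 : is_derive t (1:R) (fun t => staircase_sum n (theta - t)) (- dirichlet n (theta - t)).
    have := @is_derive1_comp R (@staircase_sum R n) (fun t => theta - t) t _ _ dK.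
    move=> /(_ (-1)) H; apply: (is_derive_eq (H _)); last by rewrite mulrN1.
    by apply: (is_derive_eq (is_deriveB (is_derive_cst _ _ _) (is_derive_id _ _))); rewrite sub0r.
  by apply: (is_derive_eq (is_deriveN dK2)); rewrite opprK.
rewrite (@continuous_FTC2 R _ F 0 s) //.
- by rewrite /F subr0 -EFinD opprK addrC.
- exact/continuous_subspaceT/continuous_dirichletB.
- have cF t : {for t, continuous F}.
    by apply: differentiable_continuous; apply/derivable1_diffP; case: (dF t).
  split.
  + by move=> t _; case: (dF t).
  + exact/cvg_at_right_filter/cF.
  + exact/cvg_at_left_filter/cF.
- by move=> t _; rewrite derive1E; have [_ ->] := dF t.
Qed.

End integrals.

Section layer_cake.
Variables (R : realType) (A : R) (g : R -> R).
Notation mu := (@lebesgue_measure R).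
Hypothesis A0 : 0 < A.
Hypothesis cg : continuous g.
Hypothesis decg : forall s t : R, 0 <= s -> s <= t -> g t <= g s.
Hypothesis gA : forall t, A <= t -> g t = 0.
Implicit Types h : R -> R.

Let gA0 : g A = 0. Proof. exact: gA. Qed.

Let g_ge0 (t : R) : 0 <= t -> 0 <= g t.
Proof.
move=> t0; have [tA|/ltW At] := leP t A; first by rewrite -gA0 decg.
by rewrite gA.
Qed.

(** The superlevel set of g at y is [0, s[.  The equation g s = y is what limits
    the levels with s on the lattice to finitely many. *)
Lemma level_point (y : R) : 0 <= y < g 0 -> exists s : R,
  [/\ 0 < s, s <= A, g s = y & forall t : R, 0 <= t -> (y < g t) = (t < s)].
Proof.
move=> /andP[y0 yG].
pose B := `[0, A] `&` (g @^-1` [set y]).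
have [c cA gc] : exists2 c, c \in `[0, A] & g c = y.
  apply: IVT; [exact: ltW|exact: continuous_subspaceT|].
  by rewrite gA0 ge_min y0 orbT le_max (ltW yG).
have cB : compact B.
  apply: compact_closedI; first exact: segment_compact.
  by apply: preimage_closed; [move=> ? _; exact: cg|exact: closed_eq].
have B0 : B !=set0 by exists c; split => //.
have [s] := compact_EVT_min B0 cB (@continuous_subspaceT _ _ B (@idfun R) (fun x => cvg_id)).
rewrite inE => -[/=]; rewrite in_itv /= => /andP[s0 sA] gs smin.
have sp : 0 < s.
  by rewrite lt_neqAle s0 andbT; apply/eqP => e; move: yG; rewrite e gs ltxx.
exists s; split => // t t0; apply/idP/idP => [|ts].
  by apply: contraTT; rewrite -!leNgt => st; rewrite -gs decg.
rewrite lt_neqAle -{2}gs decg ?(ltW ts) // andbT; apply/eqP => e.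
have := smin t; rewrite inE leNgt ts => H; suff: false by []; apply: H.
by split => //=; rewrite in_itv /= t0 (le_trans (ltW ts)).
Qed.

(** The integrand of the layer-cake formula: in the second variable it
    integrates to g h, in the first one to an integral of h over [0, s]. *)
Definition layer h (z : R * R) : R :=
  if [&& 0 <= z.1, z.1 <= A, 0 <= z.2 & z.2 < g z.1] then h z.1 else 0.

Lemma measurable_layer h : continuous h -> measurable_fun setT (layer h).
Proof.
move=> ch; have mg := continuous_measurable_fun cg.
have mh := continuous_measurable_fun ch.
apply: measurable_fun_ifT; last by [].
  repeat apply: measurable_and.
  - exact: measurable_fun_ler.
  - exact: measurable_fun_ler.
  - exact: measurable_fun_ler.
  - by apply: measurable_fun_ltr => //; exact: measurableT_comp.
exact: measurableT_comp.
Qed.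

Lemma integrable_layer h : continuous h ->
  (mu \x mu)%E.-integrable setT (EFin \o layer h).
Proof.
move=> ch; have [B B0 HB] := @bounded_on_itv R 0 A h ch.
pose S := (`[0, A] `*` `[0, g 0])%classic : set (R * R).
have mS : measurable S by exact: measurableX.
have muS : ((mu \x mu) S < +oo)%E.
  have -> : (mu \x mu)%E S = (mu `[0%R, A] * mu `[0%R, g 0])%E.
    by rewrite product_measure1E.
  rewrite !lebesgue_measure_itv /= !lte_fin.
  by case: ifP => _; case: ifP => _; rewrite -?EFinB -?EFinM ?mule0 ?mul0e ltry.
have iS : (mu \x mu)%E.-integrable setT (fun z => B%:E * (\1_S z)%:E)%E.
  apply: integrableZl => //; apply/integrableP; split.
    exact/measurable_EFinP.
  under eq_integral do rewrite gee0_abs ?lee_fin //.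
  by rewrite integral_indic // setIT.
apply: (le_integrable _ _ _ iS) => //.
  by apply/measurable_EFinP; exact: measurable_layer.
move=> [t y] _; rewrite /= /layer /= lee_fin normrM (ger0_norm B0) indicE.
case: ifPn => [/and4P[t0 tA y0 yg]|_]; last by rewrite normr0 mulr_ge0.
rewrite mem_set ?normr1 ?mulr1; first by rewrite HB // t0.
split => /=; rewrite in_itv /= ?t0 // y0 /= (le_trans (ltW yg)) //.
exact: decg.
Qed.

Lemma integral_layer h : continuous h ->
  (\int[mu]_(t in `[0%R, A]) (g t * h t)%:E = \int[mu]_y \int[mu]_t (layer h (t, y))%:E)%E.
Proof.
move=> ch; rewrite -[RHS](@Fubini _ _ _ _ R mu mu (EFin \o layer h)); last first.
  exact: integrable_layer.
rewrite integral_mkcond; apply: eq_integral => t _.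
rewrite patchE; case: ifPn => [|tA]; last first.
  rewrite integral0_eq // => y _; rewrite /= /layer /=; case: ifP => // /and4P[t0 tA' _ _].
  by move: tA; rewrite mem_set //= in_itv /= t0.
rewrite inE /= in_itv /= => /andP[t0 tA].
transitivity (\int[mu]_y ((h t)%:E * (\1_(`[0%R, g t[%classic) y)%:E))%E.
  rewrite integralZl //; last first.
    exact: (@integrable_indic_itv R 0 (g t) true true).
  rewrite integral_indic // setIT [X in (_ * X)%E](_ : _ = mu `[0, g t[%classic) //.
  rewrite lebesgue_measure_itv /= lte_fin.
  case: ifP => [_|/negbT]; first by rewrite sube0 -EFinM mulrC.
  rewrite -leNgt => gt0; have -> : g t = 0 by apply/eqP; rewrite eq_le gt0 g_ge0.
  by rewrite mul0r mule0.
apply: eq_integral => y _; rewrite -EFinM; congr EFin.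
rewrite /layer /= t0 tA /= indicE; case: ifPn => [yg|yg].
  by rewrite mem_set ?mulr1 //= in_itv.
by rewrite memNset ?mulr0 //= in_itv; apply/negP.
Qed.


Lemma measurable_integral_layer h : continuous h ->
  measurable_fun setT (fun y => \int[mu]_t (layer h (t, y))%:E)%E.
Proof.
move=> ch.
exact: (@measurable_fubini_G _ _ _ _ R mu mu (EFin \o layer h)
  (integrable_layer ch)).
Qed.

Lemma integral_layer_out h y : ~~ (0 <= y < g 0) ->
  (\int[mu]_t (layer h (t, y))%:E = 0)%E.
Proof.
move=> yG; rewrite integral0_eq // => t _; rewrite /layer /=.
case: ifP => // /and4P[t0 tA y0 yg]; move: yG.
by rewrite y0 (lt_le_trans yg) // decg.
Qed.

Lemma integral_layer_in h y s : 0 <= y -> 0 < s -> s <= A ->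
  (forall t : R, 0 <= t -> (y < g t) = (t < s)) -> continuous h ->
  (\int[mu]_t (layer h (t, y))%:E = \int[mu]_(t in `[0%R, s]) (h t)%:E)%E.
Proof.
move=> y0 s0 sA gs ch; rewrite -integral_itv_bndo_bndc; last first.
  apply/measurable_EFinP/measurable_funTS.
  exact: continuous_measurable_fun.
rewrite [RHS]integral_mkcond; apply: eq_integral => t _.
rewrite patchE /layer /= y0 /=; case: ifPn => [/and3P[t0 tA yg]|].
  by rewrite mem_set //= in_itv /= t0 -gs.
case: ifPn => // ; rewrite inE /= in_itv /= => /andP[t0 ts].
by rewrite t0 gs // ts (le_trans (ltW ts)).
Qed.

End layer_cake.

Section counting.
Variable R : realType.

Lemma sum_indic_itv (s : seq int) (a b : int) : uniq s -> a <= b ->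
  (forall j : int, a < j <= b -> j \in s) ->
  \sum_(j <- s) ((a < j <= b)%R)%:R = (b - a)%:~R :> R.
Proof.
move=> us ab sub.
rewrite -natr_sum (_ : (\sum_(j <- s) _)%N = count (fun j => a < j <= b) s); last first.
  by rewrite -sum1_count [RHS]big_mkcond /=; apply: eq_bigr => j _; case: ifP.
rewrite -size_filter (_ : (b - a)%:~R = `|b - a|%N%:R); last first.
  by rewrite natr_absz ger0_norm // subr_ge0.
congr (_%:R); rewrite -[RHS](size_iota 0) -(size_map (fun i : nat => a + 1 + i%:Z)).
apply/perm_size/uniq_perm; first exact: filter_uniq.
  by rewrite map_inj_uniq ?iota_uniq // => i j /addrI [].
move=> j; rewrite mem_filter; apply/andP/mapP => [[/andP[aj jb] _]|].
  by exists (absz (j - a - 1)%R); rewrite ?mem_iota; lia.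
case=> i; rewrite mem_iota /= => iab ->.
have jab : a < a + 1 + i%:Z <= b by lia.
by split => //; exact: sub.
Qed.

(** The point 0 belongs to both half-lines and gets half of its mass from each. *)
Definition half_weight (p : R) : R := ((0 <= p)%R%:R + (0 < p)%R%:R) / 2.

Lemma half_weight_lt0 (p : R) : p < 0 -> half_weight p = 0.
Proof. by move=> p0; rewrite /half_weight leNgt p0 lt_gtF // addr0 mul0r. Qed.

(** Between theta - r and theta the staircase jumps once at each integer - j with
    0 < theta + j < r; when theta + j = 0 only half of the jump is crossed. *)
Lemma staircase_jumps (theta r : R) (s : seq int) : uniq s -> 0 < r ->
  (forall j : int, 0 <= theta + j%:~R <= r -> j \in s) ->
  (forall j : int, j \in s -> theta + j%:~R != r) ->
  (Num.floor theta + Num.ceil theta)%:~R / 2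
   - (Num.floor (theta - r) + Num.ceil (theta - r))%:~R / 2 =
  \sum_(j <- s) half_weight (theta + j%:~R) * (theta + j%:~R < r)%R%:R.
Proof.
move=> us r0 sub sr.
have E1 (j : int) : (0 <= theta + j%:~R < r) =
    (- Num.floor theta - 1 < j <= - Num.floor (theta - r) - 1).
  have -> : (0 <= theta + j%:~R) = (- j <= Num.floor theta).
    by rewrite floor_ge_int intrN; apply/idP/idP => ?; lra.
  have -> : (theta + j%:~R < r) = (Num.floor (theta - r) < - j).
    by rewrite floor_lt_int intrN; apply/idP/idP => ?; lra.
  by apply/andP/andP => -[? ?]; lia.
have E2 (j : int) : (0 < theta + j%:~R <= r) =
    (- Num.ceil theta < j <= - Num.ceil (theta - r)).
  have -> : (0 < theta + j%:~R) = (- j < Num.ceil theta).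
    by rewrite ceil_gt_int intrN; apply/idP/idP => ?; lra.
  have -> : (theta + j%:~R <= r) = (Num.ceil (theta - r) <= - j).
    by rewrite ceil_le_int intrN; apply/idP/idP => ?; lra.
  by apply/andP/andP => -[? ?]; lia.
have H1 : \sum_(j <- s) ((0 <= theta + j%:~R < r)%R)%:R =
    (Num.floor theta - Num.floor (theta - r))%:~R :> R.
  rewrite (_ : _ - _ = (- Num.floor (theta - r) - 1) - (- Num.floor theta - 1)); last by lia.
  rewrite -(@sum_indic_itv s) //.
  - by apply: eq_bigr => j _; rewrite E1.
  - have : Num.floor (theta - r) <= Num.floor theta; last by lia.
    by rewrite floor_ge_int; have := floor_le (theta - r); lra.
  - by move=> j; rewrite -E1 => /andP[? ?]; apply: sub; lra.
have H2 : \sum_(j <- s) ((0 < theta + j%:~R <= r)%R)%:R =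
    (Num.ceil theta - Num.ceil (theta - r))%:~R :> R.
  rewrite (_ : _ - _ = (- Num.ceil (theta - r)) - (- Num.ceil theta)); last by lia.
  rewrite -(@sum_indic_itv s) //.
  - by apply: eq_bigr => j _; rewrite E2.
  - have : Num.ceil (theta - r) <= Num.ceil theta; last by lia.
    by rewrite ceil_le_int; have := ceil_ge theta; lra.
  - by move=> j; rewrite -E2 => /andP[? ?]; apply: sub; lra.
transitivity ((\sum_(j <- s) ((0 <= theta + j%:~R < r)%R)%:R +
               \sum_(j <- s) ((0 < theta + j%:~R <= r)%R)%:R) / 2 : R).
  by rewrite H1 H2 !intrD !intrN; field.
rewrite -big_split /= mulr_suml !big_seq; apply: eq_bigr => j js.
have := sr j js; rewrite /half_weight => pr.
rewrite [theta + _ <= r]le_eqVlt (negbTE pr) /=.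
by case: (theta + _ < r); rewrite ?andbT ?andbF ?mulr1 // addr0 mul0r mulr0.
Qed.

End counting.

Section halfline.
Variables (R : realType) (A : R) (g : R -> R).
Notation mu := (@lebesgue_measure R).
Hypothesis A0 : 0 < A.
Hypothesis cg : continuous g.
Hypothesis decg : forall s t : R, 0 <= s -> s <= t -> g t <= g s.
Hypothesis gA : forall t, A <= t -> g t = 0.

(** Jordan's theorem for a monotone function.  On each layer the integral of the
    kernel is an explicit difference of staircase sums, bounded uniformly in n
    and in the level, and convergent; the levels at which the limit differs from
    the stated one are finitely many. *)
Lemma jordan_halfline (theta : R) (s : seq int) : uniq s ->
  (forall j : int, 0 <= theta + j%:~R < A -> j \in s) ->
  \int[mu]_(t in `[0, A]) (g t * dirichlet n (theta - t)) @[n --> \oo] -->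
  \sum_(j <- s) half_weight (theta + j%:~R) * g (theta + j%:~R).
Proof.
move=> us sub.
pose h n t : R := dirichlet n (theta - t).
have ch n : continuous (h n) by exact: continuous_dirichletB.
pose p (j : int) : R := theta + j%:~R.
pose f_ (n : nat) (y : R) := (\int[mu]_t (layer A g (h n) (t, y))%:E)%E.
pose c (j : int) (y : R) := ((half_weight (p j))%:E * (\1_(`[0%R, g (p j)[%classic) y)%:E)%E.
pose f (y : R) : \bar R := (\sum_(j <- s) c j y)%E.
(* the bound |x| + 2 on staircase sums, at x = theta and at x = theta - r, r <= A *)
pose C : R := 2 * `|theta| + A + 4.
have C0 : 0 <= C by rewrite /C !addr_ge0 ?mulr_ge0 // ltW.
pose G (y : R) : \bar R := (C%:E * (\1_(`[0%R, g 0]%classic) y)%:E)%E.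
have ic j : mu.-integrable setT (c j).
  by apply: integrableZl => //; exact: (@integrable_indic_itv R 0 (g (p j)) true true).
have iG : mu.-integrable setT G.
  by apply: integrableZl => //; exact: (@integrable_indic_itv R 0 (g 0) true false).
have mf_ n : measurable_fun setT (f_ n) by exact: measurable_integral_layer.
have mf : measurable_fun setT f.
  by apply: emeasurable_sum => j; exact: (measurable_int mu (ic j)).
(* the levels whose layer ends at a lattice point, and the level 0, whose layer
   may end at A, where the lattice point can be missing from s *)
pose N := [set` 0 :: [seq g (p j) | j <- s]].
have cN : countable N by exact/finite_set_countable/finite_seq.
have f_f : {ae mu, forall y, setT y -> f_ ^~ y @ \oo --> f y}.
  exists N; split.
  - exact: countable_measurable.
  - exact: countable_lebesgue_measure0.
  apply/subsetCPl => y yN _.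
  have {}yN : y \notin 0 :: [seq g (p j) | j <- s] by apply/negP.
  move: yN; rewrite inE negb_or => /andP[yneq0 yNs].
  have [yG|yG] := boolP (0 <= y < g 0); last first.
    rewrite (_ : f_ ^~ y = fun=> 0%E); last first.
      by apply/funext => n; rewrite /f_ integral_layer_out.
    rewrite (_ : f y = 0%E); first exact: cvg_cst.
    rewrite /f big1 // => j _; rewrite /c.
    have [pj|pj] := ltP (p j) 0; first by rewrite half_weight_lt0 // mul0e.
    rewrite indicE memNset ?mule0 //= in_itv /= => /andP[y0 yg]; move: yG.
    by rewrite y0 (lt_le_trans yg) // decg.
  have [r [r0 rA gr gs]] := level_point A0 cg decg gA yG.
  have /andP[y0 yg0] := yG.
  have rltA : r < A.
    rewrite lt_neqAle rA andbT; apply/eqP => e.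
    by move: yneq0; rewrite -gr e gA // eqxx.
  rewrite (_ : f_ ^~ y = fun n =>
      (staircase_sum n theta - staircase_sum n (theta - r))%:E); last first.
    by apply/funext => n; rewrite /f_ (@integral_layer_in _ _ _ _ _ r) // integral_dirichlet.
  rewrite (_ : f y = ((Num.floor theta + Num.ceil theta)%:~R / 2
   - (Num.floor (theta - r) + Num.ceil (theta - r))%:~R / 2)%:E).
    by apply: cvg_EFin; [exact: nearW|apply: cvgB; exact: cvg_staircase].
  rewrite (@staircase_jumps _ _ _ s) //.
  - rewrite /f -sumEFin; apply: eq_bigr => j _; rewrite /c -EFinM; congr EFin.
    have [pj|pj] := ltP (p j) 0; first by rewrite half_weight_lt0 // !mul0r.
    congr (_ * _); rewrite indicE -(gs _ pj); congr ((nat_of_bool _)%:R); apply/idP/idP.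
      by rewrite inE /= in_itv /= => /andP[].
    by move=> yg; rewrite inE /= in_itv /= y0.
  - by move=> j /andP[? ?]; apply: sub; lra.
  - move=> j js; apply: contra yNs => /eqP e; apply/mapP; exists j => //.
    by rewrite /p e gr.
have fG : {ae mu, forall y n, setT y -> (`|f_ n y| <= G y)%E}.
  apply: aeW => y n _; rewrite /G.
  have [yG|yG] := boolP (0 <= y < g 0); last first.
    by rewrite /f_ integral_layer_out // abse0 -EFinM lee_fin mulr_ge0.
  have [r [r0 rA gr gs]] := level_point A0 cg decg gA yG.
  have /andP[y0 yg0] := yG.
  rewrite /f_ (@integral_layer_in _ _ _ _ _ r) // integral_dirichlet // indicE mem_set; last first.
    by rewrite /= in_itv /= y0 ltW.
  rewrite mule1 /= lee_fin (le_trans (ler_normB _ _)) //.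
  have K1 := norm_sawtooth_sum n theta.
  have K2 := norm_sawtooth_sum n (theta - r).
  rewrite /staircase_sum; have := ler_normD theta (sawtooth_sum n theta).
  have := ler_normD (theta - r) (sawtooth_sum n (theta - r)).
  have := ler_normB theta r; rewrite (gtr0_norm r0) /C; lra.
have [_ _ H] := @dominated_convergence _ _ R mu setT measurableT f_ f G mf_ mf f_f iG fG.
have If : (\int[mu]_y f y = (\sum_(j <- s) half_weight (p j) * g (p j))%:E)%E.
  rewrite /f integral_sum // -sumEFin; apply: eq_bigr => j _.
  rewrite /c integralZl //; last first.
    exact: (@integrable_indic_itv R 0 (g (p j)) true true).
  have [pj|pj] := ltP (p j) 0; first by rewrite half_weight_lt0 // mul0e mul0r.
  have gp0 : 0 <= g (p j).
    have [pA|/ltW Ap] := leP (p j) A; first by rewrite -(gA (lexx A)) decg.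
    by rewrite gA.
  rewrite integral_indic // setIT [X in (_ * X)%E](_ : _ = mu `[0, g (p j)[%classic) //.
  rewrite lebesgue_measure_itv /= lte_fin.
  case: ifP => [_|/negbT]; first by rewrite sube0 -EFinM.
  rewrite -leNgt => gle0; have -> : g (p j) = 0 by apply/eqP; rewrite eq_le gle0.
  by rewrite mule0 mulr0.
move: H; rewrite If => H.
rewrite (_ : (fun n => _) = fine \o (fun n => \int[mu]_y f_ n y)%E); first exact: fine_cvg.
by apply/funext => n; rewrite /= -integral_layer.
Qed.

End halfline.

(** * Poisson summation for windows *)

(** The properties of a window that Poisson summation uses; unlike [Omega], this
    class is stable under dilation, with the support as a parameter. *)
Record is_bump (R : realType) (A : R) (psi : R -> R) : Prop := {
  bump_cont : continuous psi ;
  bump_even : forall t, psi (- t) = psi t ;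
  bump_decr : forall s t, 0 <= s -> s <= t -> psi t <= psi s ;
  bump_zero : forall t, A <= t -> psi t = 0
}.

Section trig.
Variable R : realType.
Implicit Types (c t : R).

Lemma dirichletS n t : dirichlet n.+1 t = dirichlet n t + 2 * cos (2 * pi * n.+1%:R * t).
Proof. by rewrite /dirichlet big_nat_recr //= addrA. Qed.

Lemma continuous_cosM c : continuous (fun t => cos (2 * pi * (c * t)) : R).
Proof.
move=> t; apply: (@continuous_comp _ _ _ (fun t : R => 2 * pi * (c * t)) (@cos R)).
  by apply: cvgM; [exact: cvg_cst|apply: cvgM; [exact: cvg_cst|exact: cvg_id]].
exact: continuous_cos.
Qed.

Lemma continuous_sinM c : continuous (fun t => sin (2 * pi * (c * t)) : R).
Proof.
move=> t; apply: (@continuous_comp _ _ _ (fun t : R => 2 * pi * (c * t)) (@sin R)).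
  by apply: cvgM; [exact: cvg_cst|apply: cvgM; [exact: cvg_cst|exact: cvg_id]].
exact: continuous_sin.
Qed.

Lemma lipschitz_of_derive (f df : R -> R) : (forall t, is_derive t (1 : R) f (df t)) ->
  (forall t, `|df t| <= 1) -> forall x y, `|f y - f x| <= `|y - x|.
Proof.
move=> fd d1; have H x y : x <= y -> `|f y - f x| <= y - x.
  rewrite le_eqVlt => /predU1P[->|xy]; first by rewrite !subrr normr0.
  have cf : {within `[x, y], continuous f}.
    apply: continuous_subspaceT => z; apply: differentiable_continuous.
    by apply/derivable1_diffP; case: (fd z).
  have [z _ ->] := MVT xy (fun z _ => fd z) cf.
  have xy0 : 0 <= y - x by rewrite subr_ge0 ltW.
  by rewrite normrM (ger0_norm xy0) -[leRHS]mul1r ler_wpM2r.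
move=> x y; have [xy|/ltW yx] := leP x y.
  by rewrite [leRHS]ger0_norm ?subr_ge0 // H.
by rewrite distrC [leRHS]distrC [leRHS]ger0_norm ?subr_ge0 // H.
Qed.

Lemma lipschitz_cos (x y : R) : `|cos y - cos x| <= `|y - x|.
Proof.
apply: (@lipschitz_of_derive cos (fun t => - sin t)) => t; by rewrite normrN sin_max.
Qed.

Lemma lipschitz_sin (x y : R) : `|sin y - sin x| <= `|y - x|.
Proof.
apply: (@lipschitz_of_derive sin (fun t => cos t)) => t; by rewrite cos_max.
Qed.

Lemma half_weightDN (p : R) : half_weight p + half_weight (- p) = 1.
Proof. by rewrite /half_weight oppr_ge0 oppr_gt0; case: (ltgtP p 0) => /=; lra. Qed.

End trig.

Section complex_parts.
Variable R : realType.

Lemma ReD (x y : R[i]) : complex.Re (x + y) = complex.Re x + complex.Re y.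
Proof. by case: x; case: y. Qed.

Lemma ImD (x y : R[i]) : complex.Im (x + y) = complex.Im x + complex.Im y.
Proof. by case: x; case: y. Qed.

End complex_parts.

Section folding.
Variables (R : realType) (A : R) (psi : R -> R).
Notation mu := (@lebesgue_measure R).
Hypothesis A0 : 0 < A.
Hypothesis bpsi : is_bump A psi.
Implicit Types k u : R -> R.

Lemma bump_ge0 t : 0 <= psi t.
Proof.
wlog t0 : t / 0 <= t.
  move=> H; have [/H //|t0] := leP 0 t.
  by rewrite -(bump_even bpsi) H // oppr_ge0 ltW.
have [tA|/ltW At] := leP t A.
  by rewrite -(bump_zero bpsi (lexx A)) (bump_decr bpsi).
by rewrite (bump_zero bpsi).
Qed.

Lemma bump_out t : A <= `|t| -> psi t = 0.
Proof.
move=> At; have [t0|t0] := lerP 0 t.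
  by apply: (bump_zero bpsi); rewrite -(ger0_norm t0).
by rewrite -(bump_even bpsi); apply: (bump_zero bpsi); rewrite -(ltr0_norm t0).
Qed.

(** A Lipschitz factor u destroys monotonicity, but psi u = psi (u + l) - psi l
    for the linear function l t = M (A - t) + 1, and both terms are monotone. *)
Lemma jordan_bump u (M theta : R) (s : seq int) :
  continuous u -> (forall t, `|u t| <= 1) -> 0 <= M ->
  (forall x y, `|u y - u x| <= M * `|y - x|) -> uniq s ->
  (forall j : int, 0 <= theta + j%:~R < A -> j \in s) ->
  \int[mu]_(t in `[0, A]) (psi t * (u t * dirichlet n (theta - t))) @[n --> \oo] -->
  \sum_(j <- s) half_weight (theta + j%:~R) * (psi (theta + j%:~R) * u (theta + j%:~R)).
Proof.
move=> cu u1 M0 lu us sub.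
pose I (b : R -> R) n := \int[mu]_(t in `[0, A]) (psi t * b t * dirichlet n (theta - t)).
pose J (b : R -> R) := \sum_(j <- s)
  half_weight (theta + j%:~R) * (psi (theta + j%:~R) * b (theta + j%:~R)).
have main (b : R -> R) : continuous b -> (forall t, t <= A -> 0 <= b t) ->
    (forall x y, x <= y -> b y <= b x) -> I b @ \oo --> J b.
  move=> cb b0 bd; apply: (@jordan_halfline R A (fun t => psi t * b t)) => //.
  - by move=> t; apply: cvgM; [exact: (bump_cont bpsi)|exact: cb].
  - move=> x y x0 xy; have [yA|/ltW Ay] := leP y A; last first.
      rewrite (bump_zero bpsi Ay) mul0r.
      have [xA|/ltW Ax] := leP x A; first by rewrite mulr_ge0 ?bump_ge0 ?b0.
      by rewrite (bump_zero bpsi Ax) mul0r.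
    by rewrite ler_pM ?bump_ge0 ?b0 // ?bd // (bump_decr bpsi).
  - by move=> t /(bump_zero bpsi) ->; rewrite mul0r.
(* the slope M makes u + l nonincreasing, the constant 1 makes it nonnegative *)
pose l t : R := M * (A - t) + 1.
have cl : continuous l.
  move=> t; apply: cvgD; last exact: cvg_cst.
  by apply: cvgM; [exact: cvg_cst|apply: cvgB; [exact: cvg_cst|exact: cvg_id]].
have l1 t : t <= A -> 1 <= l t by move=> tA; rewrite lerDr mulr_ge0 // subr_ge0.
have cul : continuous (fun t => u t + l t).
  by move=> t; apply: cvgD; [exact: cu|exact: cl].
have H2 : I l @ \oo --> J l.
  apply: main => // [t /l1|x y xy]; first exact: le_trans.
  by rewrite lerD2r ler_wpM2l // lerB.
have H1 : I (fun t => u t + l t) @ \oo --> J (fun t => u t + l t).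
  apply: main => // [t /l1 lt1|x y xy].
    by have := u1 t; rewrite ler_norml => /andP[? _]; lra.
  have := lu x y; rewrite [X in M * X]ger0_norm ?subr_ge0 // ler_norml => /andP[_ ?].
  by rewrite /l; lra.
rewrite -[X in _ --> X]/(J u).
have -> : J u = J (fun t => u t + l t) - J l.
  by rewrite /J -sumrB; apply: eq_bigr => j _; ring.
suff -> : (fun n => \int[mu]_(t in `[0, A]) (psi t * (u t * dirichlet n (theta - t)))) =
    I (fun t => u t + l t) - I l by exact: cvgB.
apply/funext => n; have cD := @continuous_dirichletB R n theta.
have ci b : continuous b ->
    mu.-integrable `[0, A] (EFin \o (fun t => psi t * b t * dirichlet n (theta - t))).
  move=> cb; apply: continuous_itv_integrable => t; apply: cvgM; last exact: cD.
  by apply: cvgM; [exact: (bump_cont bpsi)|exact: cb].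
rewrite fctE -RintegralB //; last 2 first.
- exact: ci.
- exact: ci.
by apply: eq_Rintegral => t _; ring.
Qed.

Definition half_int k : R := \int[mu]_(t in `[0, A]) (psi t * k t).

Let integrable_half k : continuous k -> mu.-integrable `[0, A] (EFin \o (fun t => psi t * k t)).
Proof.
move=> ck; apply: continuous_itv_integrable => t.
by apply: cvgM; [exact: (bump_cont bpsi)|exact: ck].
Qed.

Lemma half_intD k1 k2 : continuous k1 -> continuous k2 ->
  half_int (fun t => k1 t + k2 t) = half_int k1 + half_int k2.
Proof.
move=> c1 c2; rewrite /half_int -RintegralD //; last 2 first.
- exact: integrable_half.
- exact: integrable_half.
by apply: eq_Rintegral => t _; rewrite mulrDr.
Qed.

Lemma half_intZ k (c : R) : continuous k ->
  half_int (fun t => c * k t) = c * half_int k.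
Proof.
move=> ck; rewrite /half_int -RintegralZl //; last exact: integrable_half.
by apply: eq_Rintegral => t _; rewrite mulrCA.
Qed.

Lemma eq_half_int k1 k2 : (forall t, k1 t = k2 t) -> half_int k1 = half_int k2.
Proof. by move=> e; apply: eq_Rintegral => t _; rewrite e. Qed.

(** The window is monotone only on the half-line, so integrals are brought there
    by evenness. *)
Lemma folding k : continuous k ->
  \int[mu]_(t in setT) (psi t * k t) = half_int (fun t => k t + k (- t)).
Proof.
move=> ck; have ckN : continuous (fun t => k (- t)).
  move=> t; apply: (@continuous_comp _ _ _ (@GRing.opp R) k); last exact: ck.
  exact: opp_continuous.
have cpk : continuous (fun t => psi t * k t).
  by move=> t; apply: cvgM; [exact: (bump_cont bpsi)|exact: ck].
rewrite half_intD // (_ : \int[mu]_(t in setT) _ =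
    \int[mu]_(t in `[- A, A]) (psi t * k t)); last first.
  rewrite [RHS]Rintegral_mkcond; apply: eq_Rintegral => t _.
  rewrite patchE; case: ifPn => // tA; rewrite bump_out ?mul0r //.
  rewrite leNgt; apply: contra tA; rewrite ltr_norml => /andP[? ?].
  by rewrite inE /= in_itv /= !ltW.
have A1 : (BLeft (- A) <= BRight (0 : R))%O by rewrite bnd_simp oppr_le0 ltW.
have A2 : (BRight (0 : R) <= BRight A)%O by rewrite bnd_simp ltW.
have iAA := @continuous_itv_integrable R (- A) A _ cpk.
have := Rintegral_itvB iAA A1 A2 => /eqP; rewrite subr_eq => /eqP ->.
congr (_ + _).
  rewrite Rintegral_itv_obnd_cbnd //.
  apply: integrableS (@continuous_itv_integrable R 0 A _ cpk) => //.
  by apply: subset_itvr; rewrite bnd_simp.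
rewrite /half_int /Rintegral -{1}oppr0 integration_by_substitution_oppr //; last first.
  exact: continuous_subspaceT.
by congr fine; apply: eq_integral => t _; rewrite /= (bump_even bpsi).
Qed.

Definition cosine_transform (v : R) : R := half_int (fun t => 2 * cos (2 * pi * (v * t))).

Lemma fourier_bump v : fourier psi v = (cosine_transform v)%:C.
Proof.
rewrite /fourier /cintegral; congr (_ +i* _).
- transitivity (\int[mu]_(t in setT) (psi t * cos (2 * pi * (v * t)))).
    by apply: eq_Rintegral => t _; rewrite /= mul0r subr0 mulrN cosN.
  rewrite folding; last exact: continuous_cosM.
  by apply: eq_half_int => t; rewrite !mulrN cosN; ring.
- transitivity (\int[mu]_(t in setT) (psi t * - sin (2 * pi * (v * t)))).
    by apply: eq_Rintegral => t _; rewrite /= mul0r addr0 mulrN sinN.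
  rewrite (folding (k := fun t => - sin (2 * pi * (v * t)))); last first.
    by move=> t; apply: cvgN; exact: continuous_sinM.
  transitivity (half_int (fun t => 0 * 1)); last first.
    by rewrite half_intZ ?mul0r // => t; exact: cvg_cst.
  by apply: eq_half_int => t; rewrite !mulrN sinN; ring.
Qed.


Lemma cosine_transformN v : cosine_transform (- v) = cosine_transform v.
Proof. by apply: eq_half_int => t; rewrite mulNr mulrN cosN. Qed.

Let continuous_2cosM x c : continuous (fun t : R => c * (2 * cos (2 * pi * (x * t)))).
Proof.
move=> t; apply: cvgM; [exact: cvg_cst|].
by apply: cvgM; [exact: cvg_cst|exact: continuous_cosM].
Qed.

Let continuousD_fun k1 k2 :
  continuous k1 -> continuous k2 -> continuous (fun t => k1 t + k2 t).
Proof. by move=> c1 c2 t; apply: cvgD; [exact: c1|exact: c2]. Qed.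

Let cosine_transform_mulr x c :
  cosine_transform x * c = half_int (fun t => c * (2 * cos (2 * pi * (x * t)))).
Proof.
rewrite mulrC -half_intZ // => t.
by apply: cvgM; [exact: cvg_cst|exact: continuous_cosM].
Qed.

Definition poisson_sum (v theta : R) (n : nat) : R[i] :=
  fourier psi v + \sum_(1 <= r < n.+1)
   (fourier psi (v + r%:R) * e2pii (r%:R * theta) +
    fourier psi (v - r%:R) * e2pii (- (r%:R * theta))).

Lemma poisson_sumS v theta n : poisson_sum v theta n.+1 = poisson_sum v theta n +
   (fourier psi (v + n.+1%:R) * e2pii (n.+1%:R * theta) +
    fourier psi (v - n.+1%:R) * e2pii (- (n.+1%:R * theta))).
Proof. by rewrite /poisson_sum big_nat_recr //= addrA. Qed.

(** Pairing r with - r produces Dirichlet kernels at theta - t and, from the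
    folded negative half-line, at theta + t; the kernel being even, the latter is
    written at - theta - t, the form required by [jordan_bump]. *)
Lemma Re_poisson_sum v theta n : complex.Re (poisson_sum v theta n) =
  half_int (fun t => cos (2 * pi * (v * t)) * dirichlet n (theta - t)) +
  half_int (fun t => cos (2 * pi * (v * t)) * dirichlet n (- theta - t)).
Proof.
have cc := @continuous_cosM R v.
have cD n' x : continuous (fun t : R => cos (2 * pi * (v * t)) * dirichlet n' (x - t)).
  by move=> t; apply: cvgM; [exact: cc|exact: continuous_dirichletB].
elim: n => [|n IHn].
  rewrite /poisson_sum big_nil addr0 fourier_bump /= -half_intD //.
  by apply: eq_half_int => t; rewrite /dirichlet !big_nil !addr0; ring.
rewrite poisson_sumS ReD IHn !fourier_bump ReD /= !mul0r !subr0.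
set r : R := n.+1%:R.
rewrite !cosine_transform_mulr -half_intD // -half_intD // -half_intD;
  [|exact: continuousD_fun|exact: continuousD_fun].
rewrite -half_intD //; apply: eq_half_int => t.
rewrite !dirichletS -/r mulrN cosN.
rewrite (_ : 2 * pi * ((v + r) * t) = 2 * pi * (v * t) + 2 * pi * (r * t)); last by ring.
rewrite (_ : 2 * pi * ((v - r) * t) = 2 * pi * (v * t) - 2 * pi * (r * t)); last by ring.
rewrite (_ : 2 * pi * r * (theta - t) = 2 * pi * (r * theta) - 2 * pi * (r * t)); last by ring.
rewrite (_ : 2 * pi * r * (- theta - t) = - (2 * pi * (r * theta) + 2 * pi * (r * t))); last by ring.
by rewrite cosN !(cosB, cosD); ring.
Qed.

Lemma Im_poisson_sum v theta n : complex.Im (poisson_sum v theta n) =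
  - (half_int (fun t => sin (2 * pi * (v * t)) * dirichlet n (theta - t)) -
     half_int (fun t => sin (2 * pi * (v * t)) * dirichlet n (- theta - t))).
Proof.
have cc := @continuous_sinM R v.
have cD n' x : continuous (fun t : R => sin (2 * pi * (v * t)) * dirichlet n' (x - t)).
  by move=> t; apply: cvgM; [exact: cc|exact: continuous_dirichletB].
elim: n => [|n IHn].
  rewrite /poisson_sum big_nil addr0 fourier_bump /=.
  apply/esym/eqP; rewrite oppr_eq0 subr_eq0; apply/eqP.
  by apply: eq_half_int => t; rewrite /dirichlet !big_nil !addr0.
rewrite poisson_sumS ImD IHn !fourier_bump ImD /= !mul0r !addr0.
set r : R := n.+1%:R.
rewrite !cosine_transform_mulr -half_intD //.
apply/eqP; rewrite eq_sym -subr_eq0; apply/eqP.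
have H : half_int (fun t => sin (2 * pi * (v * t)) * dirichlet n (theta - t)) +
    half_int (fun t => sin (2 * pi * (v * t)) * dirichlet n.+1 (- theta - t)) =
    half_int (fun t => sin (2 * pi * (v * t)) * dirichlet n (- theta - t)) +
    (half_int (fun t => sin (2 * pi * (v * t)) * dirichlet n.+1 (theta - t)) +
    half_int (fun t => sin (2 * pi * (r * theta)) * (2 * cos (2 * pi * ((v + r) * t))) +
      sin (2 * pi * - (r * theta)) * (2 * cos (2 * pi * ((v - r) * t))))).
  have c1 := continuousD_fun (@continuous_2cosM (v + r) (sin (2 * pi * (r * theta))))
                            (@continuous_2cosM (v - r) (sin (2 * pi * - (r * theta)))).
  have c2 := continuousD_fun (@cD n.+1 theta) c1.
  rewrite -half_intD // -half_intD // -half_intD //.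
  apply: eq_half_int => t; rewrite !dirichletS -/r mulrN sinN.
  rewrite (_ : 2 * pi * ((v + r) * t) = 2 * pi * (v * t) + 2 * pi * (r * t)); last by ring.
  rewrite (_ : 2 * pi * ((v - r) * t) = 2 * pi * (v * t) - 2 * pi * (r * t)); last by ring.
  rewrite (_ : 2 * pi * r * (theta - t) = 2 * pi * (r * theta) - 2 * pi * (r * t)); last by ring.
  rewrite (_ : 2 * pi * r * (- theta - t) = - (2 * pi * (r * theta) + 2 * pi * (r * t))); last by ring.
  by rewrite cosN !(cosB, cosD); ring.
by move: H => /eqP; rewrite -subr_eq0 => /eqP <-; ring.
Qed.

End folding.

Section complex_limits.
Variable R : realType.

Lemma normc_le_ReIm (w : R[i]) : normc w <= `|complex.Re w| + `|complex.Im w|.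
Proof.
case: w => a b /=.
have ab : 0 <= `|a| + `|b| by rewrite addr_ge0.
rewrite -[leRHS]ger0_norm // -sqrtr_sqr ler_wsqrtr // sqrrD !real_normK ?num_real //.
by rewrite lerD2r lerDl mulrn_wge0 // mulr_ge0.
Qed.

Lemma cvg_complex (z : nat -> R[i]) (l : R[i]) :
  complex.Re (z n) @[n --> \oo] --> complex.Re l ->
  complex.Im (z n) @[n --> \oo] --> complex.Im l ->
  (z : nat -> R[i]^o) @ \oo --> (l : R[i]^o).
Proof.
move=> /cvgrPdist_lt Hr /cvgrPdist_lt Hi; apply/cvgrPdist_lt => e e0.
have [re0 eE] : 0 < complex.Re e /\ e = (complex.Re e)%:C.
  by case: e e0 => a b; rewrite ltcE /= => /andP[/eqP -> ->].
have e2 : 0 < complex.Re e / 2 by rewrite divr_gt0.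
near=> n; rewrite eE.
rewrite (_ : `|_| = (normc (l - z n))%:C); last by case: (l - z n).
rewrite ltcR (le_lt_trans (normc_le_ReIm _)) // !raddfB /=.
rewrite [ltRHS]splitr ltrD //; near: n; [exact: Hr|exact: Hi].
Unshelve. all: by end_near. Qed.

End complex_limits.

Section poisson.
Variables (R : realType) (A : R) (psi : R -> R).
Hypothesis A0 : 0 < A.
Hypothesis bpsi : is_bump A psi.

(** The half-lines contribute with weights [half_weight p] and
    [half_weight (- p)], and these add up to 1. *)
Lemma poisson_summation (v theta : R) (s : seq int) : uniq s ->
  (forall j : int, `|theta + j%:~R| < A -> j \in s) ->
  (poisson_sum psi v theta : nat -> R[i]^o) @ \oo -->
  (\sum_(j <- s) (psi (theta + j%:~R))%:C * e2pii (- (v * (theta + j%:~R))) : R[i]^o).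
Proof.
move=> us sub.
have us' : uniq (map -%R s) by rewrite map_inj_uniq //; exact: oppr_inj.
have sub1 (j : int) : 0 <= theta + j%:~R < A -> j \in s.
  by move=> /andP[? ?]; apply: sub; rewrite ger0_norm.
have sub2 (j : int) : 0 <= - theta + j%:~R < A -> j \in map -%R s.
  move=> /andP[H1 H2]; rewrite -[j]opprK map_f //; apply: sub.
  by rewrite -normrN opprD -intrN opprK ger0_norm.
have jor (u : R -> R) (M : R) : continuous u -> (forall t, `|u t| <= 1) -> 0 <= M ->
  (forall x y, `|u y - u x| <= M * `|y - x|) ->
  half_int A psi (fun t => u t * dirichlet n (theta - t)) @[n --> \oo] -->
    \sum_(j <- s) half_weight (theta + j%:~R) * (psi (theta + j%:~R) * u (theta + j%:~R)) /\
  half_int A psi (fun t => u t * dirichlet n (- theta - t)) @[n --> \oo] -->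
    \sum_(j <- s) half_weight (- (theta + j%:~R)) * (psi (theta + j%:~R) * u (- (theta + j%:~R))).
  move=> cu u1 M0 lu; split; first exact: (jordan_bump A0 bpsi cu u1 M0 lu us sub1).
  have := jordan_bump A0 bpsi cu u1 M0 lu us' sub2; rewrite big_map.
  under eq_bigr do rewrite intrN -opprD (bump_even bpsi).
  exact.
have M0 : 0 <= 2 * pi * `|v| by rewrite !mulr_ge0 // pi_ge0.
have lip (x y : R) : `|2 * pi * (v * y) - 2 * pi * (v * x)| = 2 * pi * `|v| * `|y - x|.
  rewrite -!mulrBr !normrM [`|2|]ger0_norm // [`|pi|]ger0_norm ?pi_ge0 //.
  by rewrite !mulrA.
have lc (x y : R) : `|cos (2 * pi * (v * y)) - cos (2 * pi * (v * x))| <= 2 * pi * `|v| * `|y - x|.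
  by rewrite -lip lipschitz_cos.
have ls (x y : R) : `|sin (2 * pi * (v * y)) - sin (2 * pi * (v * x))| <= 2 * pi * `|v| * `|y - x|.
  by rewrite -lip lipschitz_sin.
have [C1 C2] := jor _ _ (@continuous_cosM R v) (fun t => cos_max _) M0 lc.
have [S1 S2] := jor _ _ (@continuous_sinM R v) (fun t => sin_max _) M0 ls.
pose p j : R := theta + j%:~R.
apply: cvg_complex.
- under eq_fun do rewrite (Re_poisson_sum A0 bpsi).
  have -> : complex.Re (\sum_(j <- s) (psi (p j))%:C * e2pii (- (v * p j))) =
      \sum_(j <- s) half_weight (p j) * (psi (p j) * cos (2 * pi * (v * p j))) +
      \sum_(j <- s) half_weight (- p j) * (psi (p j) * cos (2 * pi * (v * - p j))).
    rewrite raddf_sum -big_split /=; apply: eq_bigr => j _.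
    by rewrite !mulrN !cosN mul0r subr0 -mulrDl half_weightDN mul1r.
  exact: cvgD.
- under eq_fun do rewrite (Im_poisson_sum A0 bpsi).
  have -> : complex.Im (\sum_(j <- s) (psi (p j))%:C * e2pii (- (v * p j))) =
      - (\sum_(j <- s) half_weight (p j) * (psi (p j) * sin (2 * pi * (v * p j))) -
         \sum_(j <- s) half_weight (- p j) * (psi (p j) * sin (2 * pi * (v * - p j)))).
    rewrite raddf_sum -sumrB -sumrN /=; apply: eq_bigr => j _.
    by rewrite !mulrN !sinN !mulrN mul0r addr0 opprK -mulrDl half_weightDN mul1r.
  by apply: cvgN; exact: cvgB.
Qed.
End poisson.

(** * Dilations and the alias series *)

Section cosine_transform.
Variables (R : realType) (A : R) (psi : R -> R).
Notation mu := (@lebesgue_measure R).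
Hypothesis A0 : 0 < A.
Hypothesis bpsi : is_bump A psi.

Lemma continuous_cosine_transform : continuous (cosine_transform A psi).
Proof.
move=> v; rewrite /cosine_transform /half_int.
have vI : v \in (`]v - 1, v + 1[%classic : set R) by rewrite inE /= in_itv /=; lra.
apply: (@continuity_under_integral R _ _ mu
  (fun v t => psi t * (2 * cos (2 * pi * (v * t)))) _ _ (v - 1) (v + 1)
  _ _ (fun t => 2 * psi t)) => //.
- move=> u _; apply: continuous_itv_integrable => t.
  apply: cvgM; first exact: (bump_cont bpsi).
  by apply: cvgM; [exact: cvg_cst|exact: continuous_cosM].
- apply: aeW => t _ u _; apply: cvgM; first exact: cvg_cst.
  apply: cvgM; first exact: cvg_cst.
  rewrite (_ : (fun _ => _) = (fun u => cos (2 * pi * (t * u)))).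
    by rewrite [u * t]mulrC; exact: continuous_cosM.
  by apply/funext => x; rewrite [x * t]mulrC.
- apply: continuous_itv_integrable => t.
  by apply: cvgM; [exact: cvg_cst|exact: (bump_cont bpsi)].
- move=> u _; apply: aeW => t _; rewrite mulrCA normrM ger0_norm //.
  rewrite ler_pM2l // normrM ger0_norm ?(bump_ge0 bpsi) //.
  by rewrite -[leRHS]mulr1 ler_wpM2l ?cos_max ?(bump_ge0 bpsi).
Qed.

Lemma bump_dilate (c : R) : 0 < c -> is_bump (A / c) (fun t => psi (c * t)).
Proof.
move=> c0; split.
- move=> t; apply: (@continuous_comp _ _ _ (fun t : R => c * t) psi); last exact: (bump_cont bpsi).
  by apply: cvgM; [exact: cvg_cst|exact: cvg_id].
- by move=> t; rewrite mulrN (bump_even bpsi).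
- by move=> s t s0 st; apply: (bump_decr bpsi); [rewrite mulr_ge0 // ltW|rewrite ler_pM2l].
- by move=> t; rewrite ler_pdivrMr // mulrC => /(bump_zero bpsi).
Qed.

Lemma fourier_dilate (c v : R) : 0 < c ->
  fourier (fun t => psi (c * t)) v = (c^-1)%:C * fourier psi (v / c).
Proof.
move=> c0; have Ac : 0 < A / c by rewrite divr_gt0.
rewrite (fourier_bump Ac (bump_dilate c0)) (fourier_bump A0 bpsi) -rmorphM; congr (_%:C).
pose G t := psi t * (2 * cos (2 * pi * (v / c * t))).
have cG : continuous G.
  move=> t; apply: cvgM; first exact: (bump_cont bpsi).
  by apply: cvgM; [exact: cvg_cst|exact: continuous_cosM].
have dF (x : R) : is_derive x (1 : R) ( *%R c) c.
  by apply: (is_derive_eq (is_deriveZ c (is_derive_id x 1))); rewrite /GRing.scale /= mulr1.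
have F'E : (( *%R c : R -> R)^`())%classic = cst c.
  by apply/funext => x; rewrite derive1E; have [_ ->] := dF x.
have cF : continuous ( *%R c : R -> R).
  by move=> x; apply: cvgM; [exact: cvg_cst|exact: cvg_id].
have := @integration_by_substitution_increasing R ( *%R c) G 0 (A / c) (ltW Ac).
rewrite mulr0 mulrCA divff ?gt_eqF // mulr1 F'E => sub.
have {sub} : (\int[mu]_(x in `[0%R, A]) (G x)%:E =
  \int[mu]_(x in `[0%R, (A / c)%R]) (((G \o *%R c) * cst c) x)%:E)%E.
  apply: sub.
  - by move=> x y _ _ xy; rewrite ltr_pM2l.
  - by move=> x _; exact: cvg_cst.
  - exact: is_cvg_cst.
  - exact: is_cvg_cst.
  - split.
    + by move=> x _; case: (dF x).
    + exact/cvg_at_right_filter/cF.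
    + exact/cvg_at_left_filter/cF.
  - exact: continuous_subspaceT.
move=> E; rewrite /cosine_transform /half_int [in RHS]/Rintegral -/mu.
rewrite (_ : (\int[mu]_(x in _) _)%E = \int[mu]_(x in `[0%R, A]) (G x)%:E)%E // E.
rewrite -[fine _]/(\int[mu]_(x in `[0%R, (A / c)%R]) (((G \o *%R c) * cst c) x)).
have ci : mu.-integrable `[0, A / c] (EFin \o (fun x => c * G (c * x))).
  apply: continuous_itv_integrable => x; apply: cvgM; first exact: cvg_cst.
  by apply: (@continuous_comp _ _ _ ( *%R c : R -> R) G); [exact: cF|exact: cG].
have -> : \int[mu]_(x in `[0, A / c]) (((G \o *%R c) * cst c) x) =
    \int[mu]_(x in `[0, A / c]) (c * G (c * x)).
  by apply: eq_Rintegral => x _ /=; rewrite fctE /= mulrC.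
rewrite -RintegralZl //; apply: eq_Rintegral => x _.
by rewrite mulKf ?gt_eqF // /G [v / c * _]mulrA divfK ?gt_eqF.
Qed.

End cosine_transform.

Section omega.
Variables (R : realType) (m : nat) (sigma : R) (w : R -> R).
Hypothesis hw : Omega m sigma w.

(** The support condition forces w = 0 beyond 1, and continuity at 1 itself. *)
Lemma Omega_bump : is_bump 1 w.
Proof.
have w_out t : 1 < t -> w t = 0.
  move=> t1; apply/eqP; apply: contraTT t1 => wt0; rewrite -leNgt.
  have : closure [set t | w t != 0] t by exact: subset_closure.
  by rewrite (Omega_support hw) /= in_itv /= => /andP[].
have w1 : w 1 = 0.
  apply/eqP; apply: contraT => w10.
  have /cvgrPdist_lt /(_ `|w 1|) := Omega_continuous hw (x := 1).
  rewrite normr_gt0 => /(_ w10) H.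
  have {}H : \forall t \near (1 : R)^'+, `|w 1 - w t| < `|w 1|.
    exact: cvg_within H.
  near (1 : R)^'+ => t.
  have : `|w 1 - w t| < `|w 1| by near: t.
  have t1 : 1 < t by near: t; exact: nbhs_right_gt.
  by rewrite (w_out t t1) subr0 ltxx.
split.
- exact: Omega_continuous hw.
- exact: Omega_even hw.
- move=> s t s0 st; have [t1|t1] := leP t 1; first exact: (Omega_decr hw).
  by rewrite w_out //; have /andP[] := Omega_range hw s.
- by move=> t; rewrite le_eqVlt => /predU1P[<- //|]; exact: w_out.
Unshelve. all: by end_near. Qed.


Hypothesis m0 : (0 < m)%N.
Hypothesis sigma0 : 0 < sigma.

Let b1 := Omega_bump.

Lemma scaled_window_bump (L : R) : 0 < L -> is_bump (m%:R / L) (scaled_window w m L).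
Proof.
move=> L0; have c0 : 0 < L / m%:R by rewrite divr_gt0 // ltr0n.
rewrite (_ : scaled_window w m L = fun t => w (L / m%:R * t)); last first.
  by apply/funext => t; rewrite /scaled_window mulrAC.
rewrite (_ : m%:R / L = 1 / (L / m%:R)); last by rewrite div1r invf_div.
exact: bump_dilate.
Qed.

Lemma fourier_scaled_window (L v : R) : 0 < L ->
  fourier (scaled_window w m L) v = (m%:R / L)%:C * fourier w (m%:R * v / L).
Proof.
move=> L0; have c0 : 0 < L / m%:R by rewrite divr_gt0 // ltr0n.
rewrite (_ : scaled_window w m L = fun t => w (L / m%:R * t)); last first.
  by apply/funext => t; rewrite /scaled_window mulrAC.
rewrite (fourier_dilate ltr01 b1) // invf_div; congr (_ * fourier w _).
by rewrite mulrA [v * _]mulrC.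
Qed.

(** By monotonicity the smallest value of the transform on the band. *)
Definition edge_value : R := cosine_transform 1 w (m%:R / (2 * sigma)).

Lemma edge_value_gt0 : 0 < edge_value.
Proof.
have := @Omega_fourier_pos _ _ _ _ hw (m%:R / (2 * sigma)).
rewrite divr_ge0 ?mulr_ge0 ?(ltW sigma0) // lexx (fourier_bump ltr01 b1) ltcR.
exact.
Qed.

Lemma edge_value_le v : `|v| <= m%:R / (2 * sigma) -> edge_value <= cosine_transform 1 w v.
Proof.
move=> vb.
have := @Omega_fourier_decr _ _ _ _ hw `|v| _ (normr_ge0 _) vb (lexx _).
rewrite !(fourier_bump ltr01 b1) lecR => /le_trans; apply.
have [v0|v0] := lerP 0 v; first by rewrite ger0_norm.
by rewrite ltr0_norm // cosine_transformN.
Qed.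

Lemma fourier_scaled_window_ge (L v : R) : 0 < L -> `|v| <= L / (2 * sigma) ->
  exists2 c : R, fourier (scaled_window w m L) v = c%:C & m%:R / L * edge_value <= c.
Proof.
move=> L0 vb; rewrite fourier_scaled_window // (fourier_bump ltr01 b1) -rmorphM.
exists (m%:R / L * cosine_transform 1 w (m%:R * v / L)) => //.
have mL0 : 0 < m%:R / L by rewrite divr_gt0 // ltr0n.
rewrite ler_pM2l // edge_value_le //.
rewrite mulrAC normrM (gtr0_norm mL0).
rewrite (_ : m%:R / (2 * sigma) = m%:R / L * (L / (2 * sigma))); last first.
  by rewrite mulrA divfK // gt_eqF.
by rewrite ler_pM2l.
Qed.

Lemma fourier_scaled_window_edge (L : R) : 0 < L ->
  fourier (scaled_window w m L) (L / (2 * sigma)) = (m%:R / L * edge_value)%:C.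
Proof.
move=> L0; rewrite fourier_scaled_window // (fourier_bump ltr01 b1) -rmorphM /edge_value.
congr ((_ * cosine_transform 1 w _)%:C).
by rewrite mulrCA mulrAC divff ?mul1r // gt_eqF.
Qed.

Section alias.
Variables (L : R).
Hypothesis L0 : 0 < L.
Let psi : R -> R := scaled_window w m 1.
Let phi : R -> R := scaled_window w m L.

Let bpsi : is_bump m%:R psi.
Proof. by rewrite -[m%:R]divr1; exact: scaled_window_bump. Qed.

Lemma fourier_unit_scale v : fourier phi v = (L^-1)%:C * fourier psi (v / L).
Proof.
rewrite /phi /psi !fourier_scaled_window // mulrA -rmorphM; congr (_%:C * fourier w _).
  by rewrite divr1 mulrC.
by rewrite divr1 mulrA.
Qed.

(** Dilation by L moves the lattice to the integers.  The series lacks the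
    central term of the Poisson sum, which divided by itself gives the - 1. *)
Lemma alias_limit (v x : R) (s : seq int) : fourier phi v != 0 -> uniq s ->
  (forall j : int, `|x + j%:~R / L| < m%:R / L -> j \in s) ->
  symm_series (fun r : int =>
    fourier phi (v + r%:~R * L) / fourier phi v * e2pii (r%:~R * L * x)) =
  (L^-1)%:C *
    (\sum_(j <- s) (phi (x + j%:~R / L))%:C * e2pii (- (v * (x + j%:~R / L))))
    / fourier phi v - 1.
Proof.
move=> phi0 us sub.
have f0 : fourier psi (v / L) != 0.
  by apply: contra phi0 => /eqP e; rewrite fourier_unit_scale e mulr0.
have LC0 : (L^-1)%:C != 0 :> R[i] by rewrite fmorph_eq0 invr_eq0 gt_eqF.
have m0' : 0 < m%:R :> R by rewrite ltr0n.
have LN (j : int) : L * x + j%:~R = L * (x + j%:~R / L).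
  by rewrite mulrDr [L * (_ / L)]mulrC divfK // gt_eqF.
have sub' (j : int) : `|L * x + j%:~R| < m%:R -> j \in s.
  move=> H; apply: sub; rewrite ltr_pdivlMr // mulrC -[X in X * _](gtr0_norm L0) -normrM.
  by rewrite -LN.
have H := poisson_summation m0' bpsi (v := v / L) us sub'.
have ratio (r : R) : fourier phi (v + r * L) / fourier phi v =
    fourier psi (v / L + r) / fourier psi (v / L).
  rewrite !fourier_unit_scale mulrDl mulfK ?gt_eqF //.
  by rewrite -mulf_div divff // mul1r.
rewrite /symm_series; apply: (@cvg_lim (R[i]^o : topologicalType)); first exact: norm_hausdorff.
rewrite (_ : (fun n => _) = fun n =>
    poisson_sum psi (v / L) (L * x) n * (fourier psi (v / L))^-1 - 1); last first.
  apply/funext => n; rewrite /poisson_sum mulrDl divff // addrAC subrr add0r.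
  rewrite mulr_suml; apply: eq_bigr => r _.
  rewrite !ratio intrN mulrDl; congr (_ + _).
    by rewrite -[r%:~R * L * x]mulrA mulrAC.
  by rewrite !mulNr -[r%:~R * L * x]mulrA mulrAC.
rewrite (_ : _ * _ / _ =
  (\sum_(j <- s) (psi (L * x + j%:~R))%:C * e2pii (- (v / L * (L * x + j%:~R))))
    * (fourier psi (v / L))^-1); last first.
  rewrite fourier_unit_scale invfM mulrACA divff // mul1r; congr (_ / _).
  apply: eq_bigr => j _; rewrite LN; congr ((w _)%:C * e2pii (- _)).
    by rewrite mul1r.
  by rewrite mulrA divfK // gt_eqF.
apply: (@cvgB _ (R[i]^o) _ _ _
  (fun n => poisson_sum psi (v / L) (L * x) n / fourier psi (v / L)) (fun=> 1)).
  by apply: (@cvgM R[i] _ _ _ (poisson_sum psi (v / L) (L * x))); [exact: H|exact: cvg_cst].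
exact: cvg_cst.
Qed.

End alias.

End omega.

(** * The error constants *)

Section normc_facts.
Variable R : realType.
Implicit Types (z : R[i]) (t : R).

Lemma normc_real t : normc t%:C = `|t|.
Proof. by rewrite /= expr0n addr0 sqrtr_sqr. Qed.

Lemma normc_e2pii t : normc (e2pii t) = 1.
Proof. by rewrite /e2pii /= cos2Dsin2 sqrtr1. Qed.

Lemma normc_ge0 z : 0 <= normc z.
Proof. by case: z => a b; exact: sqrtr_ge0. Qed.

Lemma normc_sum (I : Type) (s : seq I) (F : I -> R[i]) :
  normc (\sum_(i <- s) F i) <= \sum_(i <- s) normc (F i).
Proof.
elim: s => [|i s IHs]; first by rewrite !big_nil normc0.
by rewrite !big_cons (le_trans (le_normcD _ _)) // lerD2l.
Qed.

Lemma e2piiD t u : e2pii (t + u) = e2pii t * e2pii u.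
Proof.
rewrite /e2pii mulrDr cosD sinD.
by apply/eqP; rewrite eq_complex /= eqxx addrC eqxx.
Qed.

End normc_facts.

Section error_constants.
Variables (R : realType) (m : nat) (sigma : R) (w : R -> R).
Hypothesis hw : Omega m sigma w.
Hypothesis m0 : (0 < m)%N.
Hypothesis sigma0 : 0 < sigma.

Let edge0 : 0 < edge_value m sigma w.
Proof. exact: edge_value_gt0. Qed.

Lemma half_band (K : nat) : K%:R / 2 = sigma * K%:R / (2 * sigma) :> R.
Proof. by field; rewrite gt_eqF. Qed.

Lemma fourier_band_neq0 (K : nat) (v : R) : (0 < K)%N -> `|v| <= K%:R / 2 ->
  fourier (scaled_window w m (sigma * K%:R)) v != 0.
Proof.
move=> K0; rewrite half_band => vb; have L0 : 0 < sigma * K%:R by rewrite mulr_gt0 // ltr0n.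
have [c -> cb] := fourier_scaled_window_ge hw m0 L0 vb.
rewrite fmorph_eq0 gt_eqF // (lt_le_trans _ cb) // mulr_gt0 // divr_gt0 // ltr0n.
exact: m0.
Qed.

Lemma alias_seriesE (K : nat) (v x : R) (s : seq int) (L := sigma * K%:R : R)
    (phi := scaled_window w m L : R -> R) : (0 < K)%N -> `|v| <= K%:R / 2 -> uniq s ->
  (forall j : int, `|x + j%:~R / L| < m%:R / L -> j \in s) ->
  alias_series w m sigma K v x =
  (L^-1)%:C *
    (\sum_(j <- s) (phi (x + j%:~R / L))%:C * e2pii (- (v * (x + j%:~R / L))))
    / fourier phi v - 1.
Proof.
move=> K0 vb us sub; have L0 : 0 < L by rewrite mulr_gt0 // ltr0n.
rewrite -(alias_limit hw m0 L0 _ us sub); last exact: fourier_band_neq0.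
by congr symm_series; apply/funext => r; rewrite /L mulrA.
Qed.

(** At most 2 m + 1 window values, each at most 1, divided by a lower bound of
    the transform; the last 1 is the missing central term. *)
Definition alias_bound : R := (2 * m + 1)%:R / (m%:R * edge_value m sigma w) + 1.

(** The point is that the bound involves neither K, nor v, nor x. *)
Lemma normc_alias_series (K : nat) (v x : R) : (0 < K)%N -> `|v| <= K%:R / 2 ->
  normc (alias_series w m sigma K v x) <= alias_bound.
Proof.
move=> K0 vb; have L0 : 0 < sigma * K%:R by rewrite mulr_gt0 // ltr0n.
have mR0 : 0 < m%:R :> R by rewrite ltr0n.
set L := sigma * K%:R in L0 *.
(* consecutive integers containing every j with |L x + j| < m *)
pose s := [seq Num.floor (- (L * x)) - m%:Z + i%:Z | i <- iota 0 (2 * m + 1)].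
have us : uniq s by rewrite map_inj_uniq ?iota_uniq // => i j /addrI [].
have sub (j : int) : `|x + j%:~R / L| < m%:R / L -> j \in s.
  rewrite ltr_pdivlMr // -{2}(gtr0_norm L0) -normrM mulrDl divfK ?gt_eqF //.
  rewrite ltr_norml [x * L]mulrC => /andP[lo hi].
  have jlo : Num.floor (- (L * x)) - m%:Z <= j.
    rewrite -(ler_int R) intrD intrN; have := floor_le (- (L * x)); rewrite -pmulrn; lra.
  have jhi : j - m%:Z <= Num.floor (- (L * x)).
    by rewrite floor_ge_int intrD intrN -pmulrn; lra.
  apply/mapP; exists (absz (j - (Num.floor (- (L * x)) - m%:Z))%R); last by lia.
  by rewrite mem_iota; lia.
rewrite (alias_seriesE K0 vb us sub) -/L.
rewrite (le_trans (le_normcD _ _)) // normcN normc1 /alias_bound lerD2r.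
have vb' := vb; rewrite half_band -/L in vb'.
have [c -> cb] := fourier_scaled_window_ge hw m0 L0 vb'.
have c0 : 0 < c by rewrite (lt_le_trans _ cb) // !mulr_gt0 ?invr_gt0.
rewrite !normcM normcV !normc_real (gtr0_norm c0) ger0_norm ?invr_ge0 ?(ltW L0) //.
have S : normc (\sum_(j <- s) (scaled_window w m L (x + j%:~R / L))%:C *
    e2pii (- (v * (x + j%:~R / L)))) <= (2 * m + 1)%:R.
  apply: (le_trans (normc_sum _ _)); rewrite -[X in _ <= X%:R](size_iota 0).
  rewrite -(size_map (fun i : nat => Num.floor (- (L * x)) - m%:Z + i%:Z)) -/s.
  rewrite -sum1_size natr_sum; apply: ler_sum => j _.
  rewrite normcM normc_e2pii mulr1 normc_real.
  by have /andP[w0 w1] := Omega_range hw (L * (x + j%:~R / L) / m%:R); rewrite ger0_norm.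
apply: (@le_trans _ _ (L^-1 * (2 * m + 1)%:R / (m%:R / L * edge_value m sigma w))).
  rewrite ler_pM ?mulr_ge0 ?invr_ge0 ?normc_ge0 ?(ltW L0) ?(ltW c0) //.
    by rewrite ler_wpM2l // invr_ge0 ltW.
  by rewrite lef_pV2 ?posrE // !mulr_gt0 ?invr_gt0.
rewrite le_eqVlt; apply/orP; left; apply/eqP; field.
by rewrite !gt_eqF.
Qed.

(** The three nested suprema are meaningful only because [alias_bound] bounds
    all the sets involved. *)
Lemma alias_le_error_const (K L : nat) (v x : R) : (0 < K)%N -> pos_even L ->
  sigma * K%:R = L%:R -> `|v| <= K%:R / 2 -> `|x| <= 2^-1 ->
  normc (alias_series w m sigma K v x) <= error_const w m sigma.
Proof.
move=> K0 Le sK vb xb.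
have ubK (K' : nat) : (0 < K')%N -> forall v', `|v'| <= K'%:R / 2 ->
    ubound [set normc (alias_series w m sigma K' v' x) | x in `[- 2^-1, 2^-1]%classic]
      alias_bound.
  by move=> K'0 v' v'b _ [x' _ <-]; exact: normc_alias_series.
have normCT_le (K' : nat) v' : (0 < K')%N -> `|v'| <= K'%:R / 2 ->
    norm_CT (alias_series w m sigma K' v') <= alias_bound.
  move=> K'0 v'b; apply: ge_sup; last exact: ubK.
  by exists (normc (alias_series w m sigma K' v' 0)); exists 0 => //=; rewrite in_itv /=; lra.
have constK_le (K' : nat) : (0 < K')%N -> error_const_K w m sigma K' <= alias_bound.
  move=> K'0; apply: ge_sup.
    exists (norm_CT (alias_series w m sigma K' 0)); exists 0 => //=.
    by rewrite in_itv /= oppr_le0 andbb divr_ge0.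
  by move=> y [v' /=]; rewrite in_itv /= -ler_norml => v'b <-; exact: normCT_le.
apply: (@le_trans _ _ (norm_CT (alias_series w m sigma K v))).
  apply: ub_le_sup; first by exists alias_bound; exact: ubK.
  by exists x => //=; rewrite in_itv /= -ler_norml.
apply: (@le_trans _ _ (error_const_K w m sigma K)).
  apply: ub_le_sup; last by exists v => //=; rewrite in_itv /= -ler_norml.
  exists alias_bound => y [v' /=]; rewrite in_itv /= -ler_norml => v'b <-.
  exact: normCT_le.
apply: ub_le_sup; last by exists K => //; split => //; exists L.
by exists alias_bound => _ [K' [K'0 _] <-]; exact: constK_le.
Qed.

(** The alias series times the unimodular e(v x) is the error of replacing e(v x)
    by a window sum.  Both steps of the transform are instances. *)
Lemma window_error (K L : nat) (v x : R) (s : seq int)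
    (phi := scaled_window w m L%:R : R -> R) : (0 < K)%N -> pos_even L ->
  sigma * K%:R = L%:R -> `|v| <= K%:R / 2 -> `|x| <= 2^-1 -> uniq s ->
  (forall j : int, `|x + j%:~R / L%:R| < m%:R / L%:R -> j \in s) ->
  normc ((L%:R)^-1 * (\sum_(j <- s) (phi (x + j%:~R / L%:R))%:C * e2pii (- (v * (j%:~R / L%:R))))
      / fourier phi v - e2pii (v * x)) <= error_const w m sigma.
Proof.
move=> K0 Le sK vb xb us sub.
have := alias_le_error_const K0 Le sK vb xb.
rewrite (alias_seriesE K0 vb us); last by move=> j; rewrite sK; exact: sub.
rewrite sK -/phi; apply: le_trans.
have E z : normc z = normc (e2pii (v * x) * z) by rewrite normcM normc_e2pii mul1r.
rewrite [leRHS]E mulrBr mulr1.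
rewrite le_eqVlt; apply/orP; left; apply/eqP; congr (normc (_ - _)).
rewrite !mulrA; congr (_ / _); rewrite -mulrA mulrCA; congr (_ * _).
  by rewrite fmorphV rmorph_nat.
rewrite mulr_sumr; apply: eq_bigr => j _; rewrite [RHS]mulrCA -e2piiD.
by congr (_ * e2pii _); ring.
Qed.

End error_constants.

(** * The error of the transform *)

Section complex_continuity.
Variable R : realType.
Implicit Types (g : R -> R[i]) (y : R).

Definition ccontinuous_at g y :=
  {for y, continuous (fun t => complex.Re (g t))} /\
  {for y, continuous (fun t => complex.Im (g t))}.

Lemma ccontinuous_cst (z : R[i]) y : ccontinuous_at (fun=> z) y.
Proof. by split; exact: cvg_cst. Qed.

Lemma ccontinuous_real (h : R -> R) y : {for y, continuous h} ->
  ccontinuous_at (fun t => (h t)%:C) y.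
Proof. by move=> ch; split => //=; exact: cvg_cst. Qed.

Lemma ccontinuous_e2pii (h : R -> R) y : {for y, continuous h} ->
  ccontinuous_at (fun t => e2pii (h t)) y.
Proof.
move=> ch; have c2 : {for y, continuous (fun t => 2 * pi * h t)}.
  by apply: cvgM; [exact: cvg_cst|exact: ch].
split; first exact: (continuous_comp c2 (@continuous_cos R _)).
exact: (continuous_comp c2 (@continuous_sin R _)).
Qed.

Lemma ccontinuousD g1 g2 y : ccontinuous_at g1 y -> ccontinuous_at g2 y ->
  ccontinuous_at (fun t => g1 t + g2 t) y.
Proof.
move=> [r1 i1] [r2 i2]; split.
- rewrite (_ : (fun t => _) = (fun t => complex.Re (g1 t) + complex.Re (g2 t))).
    by apply: cvgD; [exact: r1|exact: r2].
  by apply/funext => t; rewrite ReD.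
- rewrite (_ : (fun t => _) = (fun t => complex.Im (g1 t) + complex.Im (g2 t))).
    by apply: cvgD; [exact: i1|exact: i2].
  by apply/funext => t; rewrite ImD.
Qed.

Lemma ccontinuousM g1 g2 y : ccontinuous_at g1 y -> ccontinuous_at g2 y ->
  ccontinuous_at (fun t => g1 t * g2 t) y.
Proof.
move=> [r1 i1] [r2 i2]; split.
- rewrite (_ : (fun t => _) = (fun t => complex.Re (g1 t) * complex.Re (g2 t)
     - complex.Im (g1 t) * complex.Im (g2 t))).
    by apply: cvgB; apply: cvgM; [exact: r1|exact: r2|exact: i1|exact: i2].
  by apply/funext => t; case: (g1 t); case: (g2 t).
- rewrite (_ : (fun t => _) = (fun t => complex.Re (g1 t) * complex.Im (g2 t)
     + complex.Im (g1 t) * complex.Re (g2 t))).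
    by apply: cvgD; apply: cvgM; [exact: r1|exact: i2|exact: i1|exact: r2].
  by apply/funext => t; case: (g1 t); case: (g2 t).
Qed.

Lemma ccontinuous_sum (I : Type) (s : seq I) (F : I -> R -> R[i]) y :
  (forall i, ccontinuous_at (F i) y) -> ccontinuous_at (fun t => \sum_(i <- s) F i t) y.
Proof.
move=> cF; elim: s => [|i s IHs].
  rewrite (_ : (fun t => _) = fun=> 0); first exact: ccontinuous_cst.
  by apply/funext => t; rewrite big_nil.
rewrite (_ : (fun t => _) = fun t => F i t + \sum_(j <- s) F j t); first exact: ccontinuousD.
by apply/funext => t; rewrite big_cons.
Qed.

Lemma continuous_normc g y : ccontinuous_at g y -> {for y, continuous (fun t => normc (g t))}.
Proof.
move=> [r i]; rewrite (_ : (fun t => _) =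
  (fun t => Num.sqrt (complex.Re (g t) * complex.Re (g t) +
                      complex.Im (g t) * complex.Im (g t)))).
  apply: (@continuous_comp _ _ _ (fun t => complex.Re (g t) * complex.Re (g t) +
    complex.Im (g t) * complex.Im (g t)) Num.sqrt); last exact: sqrt_continuous.
  by apply: cvgD; apply: cvgM; first [exact: r|exact: i].
by apply/funext => t; case: (g t) => a b /=; rewrite !expr2.
Qed.

End complex_continuity.

Section index_set.
Variable R : realType.

Lemma idx_uniq M : uniq (idx M).
Proof.
rewrite map_inj_uniq ?iota_uniq // => i j /(congr1 (fun z => z + (M./2)%:Z)).
by rewrite !subrK => -[].
Qed.

Lemma size_idx M : size (idx M) = M.
Proof. by rewrite size_map size_iota. Qed.

Lemma mem_idx M (j : int) : ~~ odd M ->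
  (j \in idx M) = (- (M%:R / 2) <= (j%:~R : R) < M%:R / 2).
Proof.
move=> Me; have Mh : M%:R / 2 = (M./2)%:~R :> R.
  have {1}-> : M = (M./2 * 2)%N by rewrite muln2 -{1}(odd_double_half M) (negbTE Me).
  by rewrite natrM mulfK.
rewrite Mh -intrN ler_int ltr_int; apply/mapP/andP.
  by case=> i; rewrite mem_iota => iM ->; have := odd_double_half M; rewrite (negbTE Me); lia.
move=> [lo hi]; exists (absz (j + (M./2)%:Z)%R); last by lia.
by rewrite mem_iota; have := odd_double_half M; rewrite (negbTE Me); lia.
Qed.

Lemma normr_mem_idx M (j : int) : ~~ odd M -> j \in idx M -> `|j%:~R : R| <= M%:R / 2.
Proof. by move=> Me; rewrite (mem_idx _ Me) => /andP[? ?]; rewrite ler_norml; lra. Qed.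

Lemma lt_mem_idx M (j : int) : ~~ odd M -> `|j%:~R : R| < M%:R / 2 -> j \in idx M.
Proof. by move=> Me; rewrite (mem_idx _ Me) ltr_norml => /andP[? ?]; lra. Qed.

End index_set.

Section nnfft_error.
Variables (R : realType) (N N1 m1 N2 m2 M1 : nat) (sigma1 sigma2 : R) (w1 w2 : R -> R).
Variables (f : int -> R[i]) (v : int -> R).
Hypothesis hN : (0 < N)%N.
Hypothesis hsigma1 : 1 < sigma1.
Hypothesis hN1 : N1%:R = sigma1 * N%:R.
Hypothesis hN1e : pos_even N1.
Hypothesis hm1 : (1 < m1)%N.
Hypothesis hsigma2 : 1 < sigma2.
Hypothesis hN2 : N2%:R = sigma2 * (N1 + 2 * m1)%:R.
Hypothesis hN2e : pos_even N2.
Hypothesis hm2 : (1 < m2)%N.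
Hypothesis hm2N2 : (2 * m2)%:R <= (1 - sigma1^-1) * N2%:R.
Hypothesis hw1 : Omega m1 sigma1 w1.
Hypothesis hw2 : Omega m2 sigma2 w2.
Let phi1 : R -> R := scaled_window w1 m1 N1%:R.
Let phi2 : R -> R := scaled_window w2 m2 N2%:R.
Let a : R := 1 + (2 * m1)%:R / N1%:R.
Hypothesis hv : forall k, k \in idx M1 -> - (2 * a)^-1 <= v k <= (2 * a)^-1.

Let sigma1_gt0 : 0 < sigma1. Proof. exact: lt_trans hsigma1. Qed.
Let sigma2_gt0 : 0 < sigma2. Proof. exact: lt_trans hsigma2. Qed.
Let m1_gt0 : (0 < m1)%N. Proof. exact: ltnW. Qed.
Let m2_gt0 : (0 < m2)%N. Proof. exact: ltnW. Qed.
Let N1_gt0 : 0 < N1%:R :> R. Proof. by rewrite ltr0n; case/andP: hN1e. Qed.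
Let N2_gt0 : 0 < N2%:R :> R. Proof. by rewrite ltr0n; case/andP: hN2e. Qed.
Let even1 : ~~ odd (N1 + 2 * m1).
Proof. by case/andP: hN1e => _; rewrite oddD mul2n odd_double addbF. Qed.
Let even2 : ~~ odd N2. Proof. by case/andP: hN2e. Qed.

Let aE : a = (N1 + 2 * m1)%:R / N1%:R.
Proof. by rewrite /a natrD mulrDl divff // gt_eqF. Qed.

Let a_ge1 : 1 <= a.
Proof. by rewrite lerDl divr_ge0. Qed.

(** [window_error] at L = N1, v = N y, x = - v_k.  As a >= 1, |v_k| <= 1/2, so a
    window centred at v_k meets the grid only inside the index set. *)
Lemma first_window_error k y : k \in idx M1 -> `|y| <= 2^-1 ->
  normc ((N1%:R)^-1 * (\sum_(l <- idx (N1 + 2 * m1))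
      (phi1 (l%:~R / N1%:R - v k))%:C * e2pii (- (l%:~R * (y / sigma1))))
    / fourier phi1 (N%:R * y) - e2pii (- (N%:R * v k * y))) <= error_const w1 m1 sigma1.
Proof.
move=> kM yb.
have vb : `|N%:R * y| <= N%:R / 2 by rewrite normrM ger0_norm // ler_wpM2l.
have a2 : (2 * a)^-1 <= 2^-1.
  by rewrite lef_pV2 ?posrE //; have := a_ge1; lra.
have xb : `|- v k| <= 2^-1.
  by rewrite normrN ler_norml; have /andP[? ?] := hv kM; apply/andP; split; lra.
have sub (j : int) : `|- v k + j%:~R / N1%:R| < m1%:R / N1%:R -> j \in idx (N1 + 2 * m1).
  rewrite ltr_pdivlMr // -[X in _ * X](gtr0_norm N1_gt0) -normrM mulrDl divfK ?gt_eqF // => H.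
  apply: (@lt_mem_idx R) => //.
  have vN : `|v k * N1%:R| <= N1%:R / 2.
    rewrite normrM (gtr0_norm N1_gt0) mulrC ler_pM2l //.
    by move: xb; rewrite normrN.
  have := ler_normD (- v k * N1%:R + j%:~R) (v k * N1%:R).
  rewrite (_ : - v k * N1%:R + j%:~R + v k * N1%:R = j%:~R); last by ring.
  by rewrite natrD natrM; lra.
have := window_error hw1 m1_gt0 sigma1_gt0 hN hN1e (esym hN1) vb xb (idx_uniq _) sub.
rewrite -/phi1 mulrN [N%:R * y * v k]mulrAC.
rewrite (_ : \sum_(j <- _) _ = \sum_(l <- idx (N1 + 2 * m1))
  (phi1 (l%:~R / N1%:R - v k))%:C * e2pii (- (l%:~R * (y / sigma1)))) //.
apply: eq_bigr => l _; rewrite addrC; congr (_ * e2pii (- _)).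
by rewrite hN1; field; rewrite !gt_eqF // ltr0n.
Qed.

(** [window_error] at L = N2, v = - l, x = y / sigma1, summed over - s.  Here
    2 m2 <= (1 - 1/sigma1) N2 keeps the support inside the index set. *)
Lemma second_window_error l y : l \in idx (N1 + 2 * m1) -> `|y| <= 2^-1 ->
  normc ((N2%:R)^-1 * (\sum_(s <- idx N2)
      (phi2 (y / sigma1 - s%:~R / N2%:R))%:C * e2pii (- (l%:~R * s%:~R / N2%:R)))
    / fourier phi2 l%:~R - e2pii (- (l%:~R * (y / sigma1)))) <= error_const w2 m2 sigma2.
Proof.
move=> lM yb.
have vb : `|- l%:~R| <= (N1 + 2 * m1)%:R / 2 :> R by rewrite normrN normr_mem_idx.
have K0 : (0 < N1 + 2 * m1)%N by rewrite addn_gt0; case/andP: hN1e => ->.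
have xs : `|y / sigma1| <= 2^-1 / sigma1.
  by rewrite normrM [`|sigma1^-1|]gtr0_norm ?invr_gt0 // ler_pM2r ?invr_gt0.
have xb : `|y / sigma1| <= 2^-1.
  by rewrite (le_trans xs) // ler_pdivrMr // ler_peMr // ltW.
have us : uniq (map -%R (idx N2)) by rewrite map_inj_uniq ?idx_uniq //; exact: oppr_inj.
have sub (j : int) : `|y / sigma1 + j%:~R / N2%:R| < m2%:R / N2%:R -> j \in map -%R (idx N2).
  rewrite ltr_pdivlMr // -[X in _ * X](gtr0_norm N2_gt0) -normrM mulrDl divfK ?gt_eqF // => H.
  rewrite -[j]opprK map_f //; apply: (@lt_mem_idx R) => //; rewrite intrN normrN.
  have xN : `|y / sigma1 * N2%:R| <= 2^-1 / sigma1 * N2%:R.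
    by rewrite normrM (gtr0_norm N2_gt0) ler_pM2r.
  have := ler_normB (y / sigma1 * N2%:R + j%:~R) (y / sigma1 * N2%:R).
  rewrite (_ : y / sigma1 * N2%:R + j%:~R - y / sigma1 * N2%:R = j%:~R); last by ring.
  have := hm2N2; rewrite natrM; lra.
have := window_error hw2 m2_gt0 sigma2_gt0 K0 hN2e (esym hN2) vb xb us sub.
rewrite -/phi2 big_map.
have -> : fourier phi2 (- l%:~R) = fourier phi2 l%:~R.
  have A2 : 0 < m2%:R / N2%:R :> R by rewrite divr_gt0 // ltr0n.
  by rewrite !(fourier_bump A2 (scaled_window_bump hw2 m2_gt0 N2_gt0)) cosine_transformN.
rewrite mulNr (_ : \sum_(j <- _) _ = \sum_(s <- idx N2)
  (phi2 (y / sigma1 - s%:~R / N2%:R))%:C * e2pii (- (l%:~R * s%:~R / N2%:R))) //.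
apply: eq_bigr => s _; rewrite intrN mulNr; congr (_ * e2pii (- _)).
by rewrite mulrNN mulrA.
Qed.

Lemma error_const_ge0 : 0 <= error_const w2 m2 sigma2.
Proof.
have K0 : (0 < N1 + 2 * m1)%N by rewrite addn_gt0; case/andP: hN1e => ->.
apply: le_trans (normc_ge0 _)
  (alias_le_error_const hw2 m2_gt0 sigma2_gt0 (v := 0) (x := 0) K0 hN2e (esym hN2) _ _);
  by rewrite normr0 ?divr_ge0 ?invr_ge0.
Qed.

(** The window is at most 1 and there are N1 + 2 m1 = a N1 indices l. *)
Lemma sum_normc_g : \sum_(l <- idx (N1 + 2 * m1)) normc (nnfft_g N1 M1 phi1 f v l) <=
  a * \sum_(k <- idx M1) normc (f k).
Proof.
set S := \sum_(k <- idx M1) normc (f k).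
apply: (@le_trans _ _ (\sum_(l <- idx (N1 + 2 * m1)) N1%:R^-1 * S)).
  apply: ler_sum => l _; rewrite /nnfft_g normcM normcV.
  rewrite (_ : N1%:R = (N1%:R)%:C); last by rewrite rmorph_nat.
  rewrite normc_real ger0_norm // ler_pM2l ?invr_gt0 //.
  apply: (le_trans (normc_sum _ _)); apply: ler_sum => k _.
  rewrite normcM normc_real -[leRHS]mulr1 ler_wpM2l ?normc_ge0 //.
  by have /andP[? ?] := Omega_range hw1 (N1%:R * (l%:~R / N1%:R - v k) / m1%:R); rewrite ger0_norm.
rewrite big_const_seq count_predT size_idx iter_addr_0 aE -mulrnAl.
by rewrite -[N1%:R^-1 *+ _]mulr_natl.
Qed.

Lemma nnfft_s1E y : nnfft_s1 N1 m1 N2 M1 sigma1 phi1 phi2 f v y =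
  \sum_(l <- idx (N1 + 2 * m1)) nnfft_g N1 M1 phi1 f v l *
   ((N2%:R)^-1 * (\sum_(s <- idx N2)
      (phi2 (y / sigma1 - s%:~R / N2%:R))%:C * e2pii (- (l%:~R * s%:~R / N2%:R)))
    / fourier phi2 l%:~R).
Proof.
rewrite /nnfft_s1 /nnfft_h.
under eq_bigr do rewrite mulr_sumr mulr_suml.
rewrite exchange_big /=; apply: eq_bigr => l _.
rewrite mulr_sumr mulr_suml mulr_sumr; apply: eq_bigr => s _.
by ring.
Qed.

Lemma nnfft_g_sumE y : (\sum_(l <- idx (N1 + 2 * m1)) nnfft_g N1 M1 phi1 f v l *
    e2pii (- (l%:~R * (y / sigma1)))) / fourier phi1 (N%:R * y) =
  \sum_(k <- idx M1) f k * ((N1%:R)^-1 * (\sum_(l <- idx (N1 + 2 * m1))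
      (phi1 (l%:~R / N1%:R - v k))%:C * e2pii (- (l%:~R * (y / sigma1))))
    / fourier phi1 (N%:R * y)).
Proof.
rewrite mulr_suml.
under eq_bigr do rewrite /nnfft_g mulr_sumr !mulr_suml.
rewrite exchange_big /=; apply: eq_bigr => k _.
rewrite mulr_sumr mulr_suml mulr_sumr; apply: eq_bigr => l _.
by ring.
Qed.

Let err (y : R) : R :=
  normc (exp_sum N M1 f v y - nnfft_s1 N1 m1 N2 M1 sigma1 phi1 phi2 f v y
             / fourier phi1 (N%:R * y)).

Let c1 := m1%:R / N1%:R * edge_value m1 sigma1 w1.

Lemma fourier_edge : fourier phi1 (N%:R / 2) = c1%:C.
Proof.
by rewrite (half_band sigma1_gt0) -hN1 (fourier_scaled_window_edge hw1).
Qed.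

Lemma c1_gt0 : 0 < c1.
Proof. by apply: mulr_gt0; [rewrite divr_gt0 // ltr0n|exact: (edge_value_gt0 hw1)]. Qed.

Lemma fourier_first y : `|y| <= 2^-1 ->
  exists2 c, fourier phi1 (N%:R * y) = c%:C & c1 <= c.
Proof.
move=> yb; apply: (fourier_scaled_window_ge hw1 m1_gt0 N1_gt0).
by rewrite hN1 -half_band // normrM ger0_norm // ler_wpM2l.
Qed.

(** The exact exponentials e(- l y / sigma1) are inserted between the two steps.
    The first error is then averaged with the f_k, the second one with the
    g_l / phi1^ (N y), and phi1^ (N y) >= phi1^ (N / 2). *)
Lemma err_le y : `|y| <= 2^-1 -> err y <=
  (error_const w1 m1 sigma1 + a / c1 * error_const w2 m2 sigma2) *
  \sum_(k <- idx M1) normc (f k).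
Proof.
move=> yb; have [c cE cc] := fourier_first yb.
have cg0 : 0 < c := lt_le_trans c1_gt0 cc.
rewrite /err; set e := fun l : int => e2pii (- (l%:~R * (y / sigma1))).
set S := \sum_(k <- _) normc (f k).
pose B k := (N1%:R)^-1 * (\sum_(l <- idx (N1 + 2 * m1))
      (phi1 (l%:~R / N1%:R - v k))%:C * e l) / fourier phi1 (N%:R * y).
pose C l := ((N2%:R)^-1 * (\sum_(s <- idx N2)
      (phi2 (y / sigma1 - s%:~R / N2%:R))%:C * e2pii (- (l%:~R * s%:~R / N2%:R)))
    / fourier phi2 l%:~R).
pose g := nnfft_g N1 M1 phi1 f v.
have -> : exp_sum N M1 f v y -
     nnfft_s1 N1 m1 N2 M1 sigma1 phi1 phi2 f v y / fourier phi1 (N%:R * y) =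
   - (\sum_(k <- idx M1) f k * (B k - e2pii (- (N%:R * v k * y)))) -
   (\sum_(l <- idx (N1 + 2 * m1)) g l * (C l - e l)) / fourier phi1 (N%:R * y).
  have -> : \sum_(k <- idx M1) f k * (B k - e2pii (- (N%:R * v k * y))) =
      \sum_(k <- idx M1) f k * B k - exp_sum N M1 f v y.
    by rewrite /exp_sum -sumrB; apply: eq_bigr => k _; rewrite mulrBr.
  have -> : \sum_(l <- idx (N1 + 2 * m1)) g l * (C l - e l) =
      \sum_(l <- idx (N1 + 2 * m1)) g l * C l - \sum_(l <- idx (N1 + 2 * m1)) g l * e l.
    by rewrite -sumrB; apply: eq_bigr => l _; rewrite mulrBr.
  by rewrite nnfft_s1E -nnfft_g_sumE mulrBl -/g /C; ring.
have H1 : normc (\sum_(k <- idx M1) f k * (B k - e2pii (- (N%:R * v k * y)))) <=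
    error_const w1 m1 sigma1 * S.
  apply: (le_trans (normc_sum _ _)); rewrite mulr_sumr !big_seq; apply: ler_sum => k kM.
  by rewrite normcM mulrC ler_wpM2r ?normc_ge0 // first_window_error.
have H2 : normc (\sum_(l <- idx (N1 + 2 * m1)) g l * (C l - e l)) <=
    error_const w2 m2 sigma2 * (a * S).
  apply: (@le_trans _ _ (error_const w2 m2 sigma2 * \sum_(l <- idx (N1 + 2 * m1)) normc (g l))).
    apply: (le_trans (normc_sum _ _)); rewrite mulr_sumr !big_seq; apply: ler_sum => l lM.
    by rewrite normcM mulrC ler_wpM2r ?normc_ge0 // second_window_error.
  by rewrite ler_wpM2l ?error_const_ge0 // sum_normc_g.
rewrite (le_trans (le_normcD _ _)) // !normcN mulrDl lerD //.
rewrite normcM normcV cE normc_real (gtr0_norm cg0).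
have S0 : 0 <= S by apply: sumr_ge0 => k _; exact: normc_ge0.
apply: (@le_trans _ _ (error_const w2 m2 sigma2 * (a * S) / c1)).
  rewrite ler_pM ?normc_ge0 ?invr_ge0 ?(ltW cg0) //.
  by rewrite lef_pV2 ?posrE // c1_gt0.
by rewrite le_eqVlt; apply/orP; left; apply/eqP; ring.
Qed.

Lemma err_continuous : {within `[- 2^-1, 2^-1]%classic, continuous err}.
Proof.
have A1 : 0 < m1%:R / N1%:R :> R by rewrite divr_gt0 // ltr0n.
have b1 := scaled_window_bump hw1 m1_gt0 N1_gt0.
have b2 := scaled_window_bump hw2 m2_gt0 N2_gt0.
apply: continuous_in_subspaceT => y; rewrite inE /= in_itv /= -ler_norml => yb.
have cmul (c : R) : {for y, continuous (fun t => c * t)}.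
  by apply: cvgM; [exact: cvg_cst|exact: cvg_id].
apply: continuous_normc; apply: ccontinuousD.
  apply: ccontinuous_sum => k; apply: ccontinuousM; first exact: ccontinuous_cst.
  by apply: ccontinuous_e2pii; apply: cvgN; exact: cmul.
rewrite (_ : (fun t => _) = (fun t => nnfft_s1 N1 m1 N2 M1 sigma1 phi1 phi2 f v t *
    (- (cosine_transform (m1%:R / N1%:R) phi1 (N%:R * t))^-1)%:C)); last first.
  by apply/funext => t; rewrite (fourier_bump A1 b1) -fmorphV -mulrN -rmorphN.
apply: ccontinuousM.
  apply: ccontinuous_sum => s; apply: ccontinuousM; first exact: ccontinuous_cst.
  apply: ccontinuous_real.
  apply: (@continuous_comp R R R (fun t : R => t / sigma1 - s%:~R / N2%:R) phi2).
    by apply: cvgB; [apply: cvgM; [exact: cvg_id|exact: cvg_cst]|exact: cvg_cst].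
  exact: (bump_cont b2).
apply: ccontinuous_real; apply: cvgN; apply: cvgV.
  have [c cE cc] := fourier_first yb; move: cE; rewrite (fourier_bump A1 b1) => -[->].
  by rewrite gt_eqF // (lt_le_trans c1_gt0).
apply: (@continuous_comp R R R (fun t : R => N%:R * t) (cosine_transform (m1%:R / N1%:R) phi1)).
  exact: cmul.
exact: (continuous_cosine_transform b1).
Qed.

End nnfft_error.

Unset Implicit Arguments.
Set Strict Implicit.

Theorem theorem3p5 (R : realType) (N N1 m1 N2 m2 M1 M2 : nat)
    (sigma1 sigma2 : R) (w1 w2 : R -> R)
    (x : int -> R) (f : int -> R[i]) (v : int -> R)
    (hN : (0 < N)%N)
    (hsigma1 : 1 < sigma1) (hN1 : N1%:R = sigma1 * N%:R)
    (hN1e : pos_even N1)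
    (hm1 : (1 < m1)%N) (hm1N1 : (2 * m1 < N1)%N)
    (hsigma2 : 1 < sigma2) (hN2 : N2%:R = sigma2 * (N1 + 2 * m1)%:R)
    (hN2e : pos_even N2)
    (hm2 : (1 < m2)%N) (hm2N2 : (2 * m2)%:R <= (1 - sigma1^-1) * N2%:R)
    (hw1 : Omega m1 sigma1 w1) (hw2 : Omega m2 sigma2 w2)
    (hM1 : pos_even M1) (hM2 : pos_even M2)
    (hx : forall j, j \in idx M2 -> - 2^-1 <= x j <= 2^-1) :
  let phi1 := scaled_window w1 m1 N1%:R in
  let phi2 := scaled_window w2 m2 N2%:R in
  let a : R := 1 + (2 * m1)%:R / N1%:R in
  forall (hv : forall k, k \in idx M1 -> - (2 * a)^-1 <= v k <= (2 * a)^-1),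
  let err (y : R) : R :=
    normc (exp_sum N M1 f v y
           - nnfft_s1 N1 m1 N2 M1 sigma1 phi1 phi2 f v y
             / fourier phi1 (N%:R * y)) in
  exists errmax : R,
    [/\ is_maximum [set err y | y in `[- 2^-1, 2^-1]%classic] errmax,
        \big[Num.max/0]_(j <- idx M2) err (x j) <= errmax
      & errmax%:C <=
        ((error_const w1 m1 sigma1)%:C
         + a%:C / fourier phi1 (N%:R / 2) * (error_const w2 m2 sigma2)%:C)
        * (\sum_(k <- idx M1) normc (f k))%:C].
Proof.
move=> phi1 phi2 a hv err.
have half : - 2^-1 <= 2^-1 :> R by lra.
have cerr : {within `[- 2^-1, 2^-1]%classic, continuous err}.
  exact: (@err_continuous R N N1 m1 N2 m2 M1 sigma1 sigma2).
have [c cI cmax] := EVT_max half cerr.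
exists (err c); split.
- split; first by exists c.
  by move=> _ [y yI <-]; exact: cmax.
- rewrite big_seq; apply: (big_ind (fun z => z <= err c)) => [|p q pc qc|j jM].
  + exact: normc_ge0.
  + by rewrite ge_max pc.
  + by apply: cmax; rewrite in_itv; exact: hx.
rewrite (fourier_edge hsigma1 hN1 hN1e hm1 hw1) -fmorphV -!rmorphM -rmorphD -rmorphM lecR.
apply: (@err_le R N N1 m1 N2 m2 M1 sigma1 sigma2) => //.
by rewrite ler_norml; move: cI; rewrite in_itv.
Qed.
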